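(* Let $A$ be a $C^*$-algebra, let $p_1,p_2$ be projections in $A^{**}$, let $X$ be a linear subspace of $p_1A^{**}p_2$ which satisfies $K(p_1,p_2)$, and let $T:X\to A^{**}$ be a purely decomposable linear transformation. (a) For each irreducible representation $\pi:A\to B(H_\pi)$ such that $\pi^{**}(p_1)\neq 0$ and $\pi^{**}(p_2)\ne 0$, there is a linear transformation $t_\pi:\pi^{**}(p_1)H_\pi\to H_\pi$ such that $\pi^{**}(Tx)=t_\pi\pi^{**}(x)$ for all $x\in X$. Also, if $\pi$ is irreducible and $\pi^{**}(p_1)$ or $\pi^{**}(p_2)$ is $0$, then $\pi^{**}[T(X)]=\{0\}$. In (b) and (c), $\pi$ is any irreducible representation of $A$ with $\pi^{**}(p_1),\pi^{**}(p_2)\neq0$ and $t_\pi$ is the transformation in (a). (b) If $T$ is bounded, then $t_\pi$ is bounded and $\|t_\pi\|\le k(\pi)\|T\|$. (c) If $X$ is norm closed and either $\pi^{**}(p_2)$ has infinite rank or $\pi^{**}(p_1)$ has finite rank, then $t_\pi$ is bounded. (d) Assume that $X$ is norm closed, that $T(X)$ is of type $\mathcal U$, and that for each irreducible representation $\pi$ of $A$ at least one of the following holds: (i) $\pi^{**}(p_2)=0$; (ii) $\pi^{**}(p_2)$ has infinite rank; (iii) $\pi^{**}(p_1)$ has finite rank. Then $T$ is bounded.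
   Context: $A^{**}$ is the enveloping von Neumann algebra (bidual) of $A$. States of $A$ are identified with normal states of $A^{**}$, and for a representation $\pi:A\to B(H)$, $\pi^{**}:A^{**}\to B(H)$ denotes its unique normal extension. $P(A)$ is the set of pure states of $A$. Purely decomposable: if $X$ is a subspace of $A^{**}$, a linear transformation $T:X\to A^{**}$ (not assumed bounded) is purely decomposable if for all $\varphi\in P(A)$ and all $x\in X$, $\varphi(x^*x)=0$ implies $\varphi[(Tx)^*(Tx)]=0$. Condition $K(p_1,p_2)$: a subspace $X$ of $p_1A^{**}p_2$ satisfies $K(p_1,p_2)$ if whenever $\pi:A\to B(H)$ is an irreducible representation with $\pi^{**}(p_1),\pi^{**}(p_2)\ne 0$ and $V$ is a non-zero finite dimensional subspace of $\pi^{**}(p_2)H$, there is a positive number $k(\pi,V)$ such that for any $t\in \pi^{**}(p_1)B(H)$ there is $x\in X$ with $\|x\|\le k(\pi,V)\|t\|$ and $\pi^{**}(x)_{|V}=t_{|V}$. In that case, for such $\pi$, $k(\pi)$ denotes $\inf\{k(\pi,V): V \text{ is a 1-dimensional subspace of } \pi^{**}(p_2)H\}$. Type $\mathcal U$: let $\pi_a$ be the reduced atomic representation of $A$ (the direct sum of one irreducible representation from each unitary equivalence class). A subspace $Y$ of $A^{**}$ is of type $\mathcal U$ if for every $y$ in the norm closure $\overline Y$, $\pi_a^{**}(y)=0$ implies $y=0$. *)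

(* Defs.v *)
From HB Require Import structures.
From mathcomp Require Import all_boot all_order all_algebra.
From mathcomp Require Import complex.
From mathcomp Require Import all_classical all_reals.
From mathcomp Require Import topology normedtype.

Set Implicit Arguments.
Unset Strict Implicit.
Unset Printing Implicit Defensive.

Import Order.TTheory GRing.Theory Num.Theory.
Import numFieldNormedType.Exports.

Local Open Scope classical_set_scope.
Local Open Scope complex_scope.
Local Open Scope ring_scope.

Section subspaces.
Context {R : realType}.
Implicit Types V W : lmodType R[i].

Definition linear_subspace {V} (X : set V) :=
  X 0 /\ forall c x y, X x -> X y -> X (c *: x + y).

(* Only the values of [f] on [X] matter: this is linearity of a map defined
   on the subspace [X], extended arbitrarily to the ambient space. *)
Definition linear_on {V W} (X : set V) (f : V -> W) :=
  forall c x y, X x -> X y -> f (c *: x + y) = c *: f x + f y.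

Definition spanned {V n} (v : 'I_n -> V) : set V :=
  [set \sum_(i < n) c i *: v i | c in [set: 'I_n -> R[i]]].

Definition finite_dim {V} (X : set V) :=
  exists n (v : 'I_n -> V), X = spanned v.

Definition one_dim {V} (X : set V) :=
  exists2 v, v != 0 & X = [set c *: v | c in [set: R[i]]].

End subspaces.

(* In a [normedModType R[i]] the norm takes values in [R[i]]; it is real, and
   [normr_re] is the same number in [R]. *)
Definition normr_re {R : realType} {V : normedModType R[i]} (x : V) : R :=
  complex.Re `|x|.

Section bounded_maps.
Context {R : realType} {V W : normedModType R[i]}.

Definition bounded_on (X : set V) (f : V -> W) :=
  exists M : R, forall x, X x -> normr_re (f x) <= M * normr_re x.

Definition opnorm_on (X : set V) (f : V -> W) : R :=
  sup [set normr_re (f x) | x in [set x | X x /\ normr_re x <= 1]].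

End bounded_maps.

Record blin {R : realType} (V W : normedModType R[i]) := BLin {
  blin_fun :> V -> W;
  blin_linear : linear blin_fun;
  blin_bounded : bounded_on [set: V] blin_fun }.

Notation "''B' ( V , W )" := (blin V W)
  (at level 8, format "''B' ( V ,  W )") : type_scope.

Section blin_theory.
Context {R : realType}.

Lemma normr_reE (V : normedModType R[i]) (x : V) : (normr_re x)%:C = `|x|.
Proof. by rewrite RRe_real// normr_real. Qed.

Lemma normr_re_ge0 (V : normedModType R[i]) (x : V) : 0 <= normr_re x.
Proof. by rewrite -lecR normr_reE normr_ge0. Qed.

Lemma ler_normr_reD (V : normedModType R[i]) (x y : V) :
  normr_re (x + y) <= normr_re x + normr_re y.
Proof. by rewrite -lecR rmorphD /= !normr_reE ler_normD. Qed.

Lemma normr_reZ (V : normedModType R[i]) (c : R[i]) (x : V) :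
  normr_re (c *: x) = normr_re (c : R[i]^o) * normr_re x.
Proof. by apply: complexI; rewrite rmorphM /= !normr_reE normrZ. Qed.

Lemma normr_re0 (V : normedModType R[i]) : normr_re (0 : V) = 0.
Proof. by rewrite /normr_re normr0. Qed.

Lemma normr_re_eq0 (V : normedModType R[i]) (x : V) : normr_re x = 0 -> x = 0.
Proof. by move=> x0; apply/normr0_eq0; rewrite -normr_reE x0. Qed.

Context {V W : normedModType R[i]}.
Implicit Types f g : 'B(V, W).

HB.instance Definition _ f :=
  GRing.isLinear.Build R[i] V W *:%R (blin_fun f) (blin_linear f).

Lemma blinP f g : f =1 g -> f = g.
Proof.
case: f g => f fl fb [g gl gb] /= /funext fg; subst g.
by congr BLin; exact: Prop_irrelevance.
Qed.

HB.instance Definition _ := gen_eqMixin 'B(V, W).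
HB.instance Definition _ := gen_choiceMixin 'B(V, W).


Lemma blin_zero_subproof :
  linear (fun _ : V => 0 : W) /\ bounded_on [set: V] (fun _ : V => 0 : W).
Proof.
split=> [c x y|]; first by rewrite scaler0 addr0.
by exists 0 => x _; rewrite mul0r normr_re0.
Qed.

Lemma blin_opp_subproof f :
  linear (fun x : V => - f x) /\ bounded_on [set: V] (fun x => - f x).
Proof.
split=> [c x y|]; first by rewrite linearP opprD scalerN.
by have [M fM] := blin_bounded f; exists M => x; rewrite /normr_re normrN => /fM.
Qed.

Lemma blin_add_subproof f g :
  linear (fun x : V => f x + g x) /\ bounded_on [set: V] (fun x => f x + g x).
Proof.
split=> [c x y|]; first by rewrite !linearP scalerDr addrACA.
have [M fM] := blin_bounded f; have [N gN] := blin_bounded g.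
exists (M + N) => x xV; rewrite mulrDl.
by apply: (le_trans (ler_normr_reD _ _)); rewrite lerD ?fM ?gN.
Qed.

Lemma blin_scale_subproof (a : R[i]) f :
  linear (fun x : V => a *: f x) /\ bounded_on [set: V] (fun x => a *: f x).
Proof.
split=> [c x y|]; first by rewrite linearP scalerDr !scalerA mulrC.
have [M fM] := blin_bounded f.
exists (normr_re (a : R[i]^o) * M) => x xV.
by rewrite normr_reZ -mulrA ler_wpM2l ?normr_re_ge0 ?fM.
Qed.

Definition blin_of (f : V -> W) (fP : linear f /\ bounded_on [set: V] f) :=
  BLin fP.1 fP.2.

Let zero := blin_of blin_zero_subproof.
Let opp f := blin_of (blin_opp_subproof f).
Let add f g := blin_of (blin_add_subproof f g).
Let scale a f := blin_of (blin_scale_subproof a f).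

Fact blin_addA : associative add.
Proof. by move=> f g h; apply/blinP => x /=; rewrite addrA. Qed.
Fact blin_addC : commutative add.
Proof. by move=> f g; apply/blinP => x /=; rewrite addrC. Qed.
Fact blin_add0 : left_id zero add.
Proof. by move=> f; apply/blinP => x /=; rewrite add0r. Qed.
Fact blin_addN : left_inverse zero opp add.
Proof. by move=> f; apply/blinP => x /=; rewrite addNr. Qed.

HB.instance Definition _ := GRing.isZmodule.Build 'B(V, W)
  blin_addA blin_addC blin_add0 blin_addN.

Fact blin_scaleA a b f : scale a (scale b f) = scale (a * b) f.
Proof. by apply/blinP => x /=; rewrite scalerA. Qed.
Fact blin_scale1 : left_id 1 scale.
Proof. by move=> f; apply/blinP => x /=; rewrite scale1r. Qed.
Fact blin_scaleDr : right_distributive scale +%R.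
Proof. by move=> a f g; apply/blinP => x /=; rewrite scalerDr. Qed.
Fact blin_scaleDl f : {morph scale^~ f : a b / a + b}.
Proof. by move=> a b; apply/blinP => x /=; rewrite scalerDl. Qed.

HB.instance Definition _ := GRing.Zmodule_isLmodule.Build R[i] 'B(V, W)
  blin_scaleA blin_scale1 blin_scaleDr blin_scaleDl.

Lemma blinDE f g x : (f + g) x = f x + g x. Proof. by []. Qed.
Lemma blinNE f x : (- f) x = - f x. Proof. by []. Qed.
Lemma blinZE a f x : (a *: f) x = a *: f x. Proof. by []. Qed.
Lemma blin0E x : (0 : 'B(V, W)) x = 0. Proof. by []. Qed.

Definition opnorm f : R := opnorm_on [set: V] f.

Lemma has_sup_opnorm f : has_sup
  [set normr_re (f x) | x in [set x | [set: V] x /\ normr_re x <= 1]].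
Proof.
split; first by exists (normr_re (f 0)), 0 => //=; rewrite normr_re0 ler01.
have [M fM] := blin_bounded f; exists `|M| => _ [x [_ x1] <-].
apply: (le_trans (fM x I)); rewrite (le_trans (ler_norm _))// normrM.
by rewrite ler_piMr// ger0_norm ?normr_re_ge0.
Qed.

Lemma opnorm_ge0 f : 0 <= opnorm f.
Proof.
apply: (le_trans (normr_re_ge0 (f 0))).
by apply: ub_le_sup; [exact: (has_sup_opnorm f).2|exists 0 => //=; rewrite normr_re0 ler01].
Qed.

Lemma le_opnorm f x : normr_re (f x) <= opnorm f * normr_re x.
Proof.
have [x0|x0] := eqVneq (normr_re x) 0.
  by rewrite (normr_re_eq0 x0) linear0 !normr_re0 mulr0.
have xgt0 : 0 < normr_re x by rewrite lt_def x0 normr_re_ge0.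
rewrite -ler_pdivrMr// mulrC.
have nV : normr_re ((normr_re x)^-1%:C : R[i]^o) = (normr_re x)^-1.
  by apply: complexI; rewrite normr_reE ger0_norm// ler0c invr_ge0 ltW.
rewrite -{1}nV -normr_reZ -linearZ.
apply: ub_le_sup; first exact: (has_sup_opnorm f).2.
by exists ((normr_re x)^-1%:C *: x) => //=; rewrite normr_reZ nV mulVf.
Qed.

Lemma opnorm_le f (M : R) :
  (forall x, normr_re x <= 1 -> normr_re (f x) <= M) -> opnorm f <= M.
Proof.
move=> fM; apply: ge_sup; first exact: (has_sup_opnorm f).1.
by move=> _ [x [_ x1] <-]; exact: fM.
Qed.

Fact blin_ler_normD f g :
  (opnorm (f + g))%:C <= (opnorm f)%:C + (opnorm g)%:C.
Proof.
rewrite -rmorphD /= lecR; apply: opnorm_le => x x1.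
apply: (le_trans (ler_normr_reD _ _)); apply: lerD.
- by apply: (le_trans (le_opnorm f x)); rewrite ler_piMr ?opnorm_ge0.
- by apply: (le_trans (le_opnorm g x)); rewrite ler_piMr ?opnorm_ge0.
Qed.

Fact blin_normr0_eq0 f : (opnorm f)%:C = 0 -> f = 0.
Proof.
move/(@complexI R _ 0) => f0; apply/blinP => x; apply: normr_re_eq0; apply: le_anti.
by rewrite normr_re_ge0 andbT (le_trans (le_opnorm f x))// f0 mul0r.
Qed.

Fact blin_normrZ (a : R[i]) f : (opnorm (a *: f))%:C = `|a| * (opnorm f)%:C.
Proof.
have le (b : R[i]) g : opnorm (b *: g) <= normr_re (b : R[i]^o) * opnorm g.
  apply: opnorm_le => x x1; rewrite blinZE normr_reZ ler_wpM2l ?normr_re_ge0//.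
  by rewrite (le_trans (le_opnorm g x))// ler_piMr ?opnorm_ge0.
rewrite -[`|a|](@normr_reE R[i]^o a) -rmorphM; congr (_%:C).
apply: le_anti; rewrite le /=.
have [->|a0] := eqVneq a 0; first by rewrite scale0r normr_re0 mul0r opnorm_ge0.
have na : normr_re (a : R[i]^o) != 0 by apply: contra_neq a0 => /normr_re_eq0.
have na0 : 0 < normr_re (a : R[i]^o) by rewrite lt_def na normr_re_ge0.
rewrite mulrC -ler_pdivlMr//.
have {1}-> : f = a^-1 *: (a *: f) by rewrite scalerA mulVf ?scale1r.
rewrite (le_trans (le _ _))// mulrC ler_wpM2l ?opnorm_ge0//.
rewrite le_eqVlt; apply/orP; left; apply/eqP.
apply: complexI; rewrite normr_reE fmorphV /= normr_reE; exact: normfV.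
Qed.

HB.instance Definition _ := Lmodule_isNormed.Build R[i] 'B(V, W)
  blin_ler_normD blin_normrZ blin_normr0_eq0.

Lemma normr_re_blin f : normr_re f = opnorm f. Proof. by []. Qed.

End blin_theory.

HB.mixin Record NormedModule_isHilbert (R : realType) (H : Type)
    & CompleteNormedModule R[i] H := {
  inner : H -> H -> R[i];
  inner_linearl : forall c x y z,
    inner (c *: x + y) z = c * inner x z + inner y z;
  inner_conj : forall x y, inner y x = ((inner x y)^*)%R;
  inner_norm : forall x, inner x x = `|x| ^+ 2 }.

#[short(type="hilbertType")]
HB.structure Definition Hilbert (R : realType) :=
  {H of CompleteNormedModule R[i] H & NormedModule_isHilbert R H}.

(* C*-algebras are not assumed unital. *)
HB.mixin Record NormedModule_isCStarAlgebra (R : realType) (A : Type)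
    & CompleteNormedModule R[i] A := {
  cmul : A -> A -> A;
  cstar : A -> A;
  cmul_linearl : forall c x y z, cmul (c *: x + y) z = c *: cmul x z + cmul y z;
  cmul_linearr : forall c x y z, cmul z (c *: x + y) = c *: cmul z x + cmul z y;
  cmulA : associative cmul;
  cstar_semilinear : forall c x y,
    cstar (c *: x + y) = (c^*)%R *: cstar x + cstar y;
  cstarK : involutive cstar;
  cstarM : forall x y, cstar (cmul x y) = cmul (cstar y) (cstar x);
  normr_cmul : forall x y, `|cmul x y| <= `|x| * `|y|;
  normr_cstar_cmul : forall x, `|cmul (cstar x) x| = `|x| ^+ 2 }.

#[short(type="cstarAlgType")]
HB.structure Definition CStarAlgebra (R : realType) :=
  {A of CompleteNormedModule R[i] A & NormedModule_isCStarAlgebra R A}.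

Notation dual V := (blin V (complex _)^o).
Notation bidual V := (dual (dual V)).

Section enveloping_algebra.
Context {R : realType} {A : cstarAlgType R}.
Implicit Types (a b : A) (f : dual A) (F G : bidual A).

Fact normr_re_cmul a b : normr_re (cmul a b) <= normr_re a * normr_re b.
Proof. by rewrite -lecR rmorphM /= !normr_reE; exact: normr_cmul. Qed.

Fact normr_re_cstar a : normr_re (cstar a) = normr_re a.
Proof.
have le b : normr_re b <= normr_re (cstar b).
  have [->|b0] := eqVneq (normr_re b) 0; first exact: normr_re_ge0.
  have bgt0 : 0 < normr_re b by rewrite lt_def b0 normr_re_ge0.
  rewrite -(ler_pM2r bgt0); apply: le_trans (normr_re_cmul _ _).
  by rewrite -lecR rmorphM /= !normr_reE normr_cstar_cmul -expr2.
by apply: le_anti; rewrite le -{2}[a]cstarK le.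
Qed.

Fact blin_le (V W : normedModType R[i]) (f : 'B(V, W)) x :
  normr_re (f x) <= normr_re f * normr_re x.
Proof. exact: le_opnorm. Qed.

(* The enveloping von Neumann algebra is the bidual with the Arens product
   (F G)(f) = F (G f), (G f)(a) = G (f a), (f a)(b) = f (a b), the two Arens
   products of a C*-algebra being equal, and with the involution
   F^*(f) = (F (f^* ))^*, f^*(a) = (f (a^* ))^*. *)
Fact dual_act_subproof f a :
  linear (fun b => f (cmul a b) : R[i]^o) /\
  bounded_on [set: A] (fun b => f (cmul a b) : R[i]^o).
Proof.
split=> [c x y|]; first by rewrite cmul_linearr linearP.
exists (normr_re f * normr_re a) => b _.
rewrite (le_trans (blin_le _ _))// -mulrA ler_wpM2l ?normr_re_ge0//.
exact: normr_re_cmul.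
Qed.
Definition dual_act f a : dual A := blin_of (dual_act_subproof f a).

Fact dual_act_le f a : normr_re (dual_act f a) <= normr_re f * normr_re a.
Proof.
apply: opnorm_le => b b1 /=; rewrite (le_trans (blin_le _ _))//.
rewrite ler_wpM2l ?normr_re_ge0// (le_trans (normr_re_cmul _ _))//.
by rewrite ler_piMr ?normr_re_ge0.
Qed.

Fact bidual_act_subproof G f :
  linear (fun a => G (dual_act f a) : R[i]^o) /\
  bounded_on [set: A] (fun a => G (dual_act f a) : R[i]^o).
Proof.
split=> [c x y|].
  rewrite -linearP; congr (G _); apply/blinP => b /=.
  by rewrite cmul_linearl linearP.
exists (normr_re G * normr_re f) => b _.
rewrite (le_trans (blin_le _ _))// -mulrA ler_wpM2l ?normr_re_ge0//.
exact: dual_act_le.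
Qed.
Definition bidual_act G f : dual A := blin_of (bidual_act_subproof G f).

Fact bidual_act_le G f : normr_re (bidual_act G f) <= normr_re G * normr_re f.
Proof.
apply: opnorm_le => b b1 /=; rewrite (le_trans (blin_le _ _))//.
rewrite ler_wpM2l ?normr_re_ge0// (le_trans (dual_act_le _ _))//.
by rewrite ler_piMr ?normr_re_ge0.
Qed.

Fact bmul_subproof F G :
  linear (fun f => F (bidual_act G f) : R[i]^o) /\
  bounded_on [set: dual A] (fun f => F (bidual_act G f) : R[i]^o).
Proof.
split=> [c f g|].
  rewrite -linearP; congr (F _); apply/blinP => a /=.
  by rewrite -linearP; congr (G _); exact/blinP.
exists (normr_re F * normr_re G) => f _.
rewrite (le_trans (blin_le _ _))// -mulrA ler_wpM2l ?normr_re_ge0//.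
exact: bidual_act_le.
Qed.
Definition bmul F G : bidual A := blin_of (bmul_subproof F G).

Fact normr_re_conj (z : R[i]) :
  normr_re ((z^*)%R : R[i]^o) = normr_re (z : R[i]^o).
Proof. by rewrite /normr_re; congr complex.Re; exact: norm_conjC. Qed.

Fact dual_star_subproof f :
  linear (fun a => ((f (cstar a))^*)%R : R[i]^o) /\
  bounded_on [set: A] (fun a => ((f (cstar a))^*)%R : R[i]^o).
Proof.
split=> [c x y|].
  by rewrite cstar_semilinear linearP rmorphD rmorphM /= conjCK.
exists (normr_re f) => a _.
by rewrite normr_re_conj (le_trans (blin_le _ _))// normr_re_cstar.
Qed.
Definition dual_star f : dual A := blin_of (dual_star_subproof f).

Fact dual_star_le f : normr_re (dual_star f) <= normr_re f.
Proof.
apply: opnorm_le => a a1; rewrite /= normr_re_conj (le_trans (blin_le _ _))//.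
by rewrite normr_re_cstar ler_piMr ?normr_re_ge0.
Qed.

Fact bstar_subproof F :
  linear (fun f => ((F (dual_star f))^*)%R : R[i]^o) /\
  bounded_on [set: dual A] (fun f => ((F (dual_star f))^*)%R : R[i]^o).
Proof.
split=> [c f g|].
  have -> : dual_star (c *: f + g) = (c^*)%R *: dual_star f + dual_star g.
    by apply/blinP => a /=; rewrite rmorphD rmorphM.
  by rewrite linearP rmorphD rmorphM /= conjCK.
exists (normr_re F) => f _; rewrite normr_re_conj (le_trans (blin_le _ _))//.
by rewrite ler_wpM2l ?normr_re_ge0 ?dual_star_le.
Qed.
Definition bstar F : bidual A := blin_of (bstar_subproof F).

Fact beval_subproof a :
  linear (fun f : dual A => f a : R[i]^o) /\
  bounded_on [set: dual A] (fun f : dual A => f a : R[i]^o).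
Proof.
by split=> [c f g //|]; exists (normr_re a) => f _; rewrite mulrC blin_le.
Qed.
Definition beval a : bidual A := blin_of (beval_subproof a).

Lemma bevalM a b : beval (cmul a b) = bmul (beval a) (beval b).
Proof. exact/blinP. Qed.

Lemma beval_star a : beval (cstar a) = bstar (beval a).
Proof. by apply/blinP => f /=; rewrite conjCK. Qed.

Definition projection F := bstar F = F /\ bmul F F = F.

Definition corner p1 p2 : set (bidual A) :=
  [set bmul p1 (bmul F p2) | F in [set: bidual A]].

Definition state f := (forall a, 0 <= f (cmul (cstar a) a)) /\ normr_re f = 1.

Definition pure_state f := state f /\
  forall f1 f2 (t : R), state f1 -> state f2 -> 0 < t < 1 ->
    f = t%:C *: f1 + (1 - t)%:C *: f2 -> f1 = f /\ f2 = f.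

(* The value at F of the normal state extending f is F f. *)
Definition purely_decomposable (X : set (bidual A)) T :=
  forall f F, pure_state f -> X F ->
    bmul (bstar F) F f = 0 -> bmul (bstar (T F)) (T F) f = 0.

End enveloping_algebra.

Section representations.
Context {R : realType}.
Implicit Types (A : cstarAlgType R) (H K : hilbertType R).

(* Boundedness of a *-homomorphism A -> B(H) is automatic; it is part of the
   type of [rep_fun] so that matrix coefficients are elements of the dual. *)
Record representation A H := Representation {
  rep_fun :> 'B(A, 'B(H, H));
  rep_mul : forall a b x, rep_fun (cmul a b) x = rep_fun a (rep_fun b x);
  rep_star : forall a x y,
    inner (rep_fun (cstar a) x) y = inner x (rep_fun a y) }.

(* Normality: the functionals <. x, y>, whose closed span is the predual of
   B(H), are pulled back to elements of the predual A^* of A^**. *)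
Definition normal_extension A H (pi : representation A H)
    (Pi : bidual A -> 'B(H, H)) :=
  (forall x y, exists f : dual A, forall F, inner (Pi F x) y = F f) /\
  (forall a, Pi (beval a) = pi a).

Lemma normal_extension_unique A H (pi : representation A H) Pi1 Pi2 :
  normal_extension pi Pi1 -> normal_extension pi Pi2 -> Pi1 = Pi2.
Proof.
move=> [n1 e1] [n2 e2]; apply/funext => F; apply/blinP => x.
have h y : inner (Pi1 F x) y = inner (Pi2 F x) y.
  have [f1 h1] := n1 x y; have [f2 h2] := n2 x y; rewrite h1 h2.
  congr (F _); apply/blinP => a.
  by rewrite -[f1 a](h1 (beval a)) -[f2 a](h2 (beval a)) e1 e2.
apply/eqP; rewrite -subr_eq0 -normr_eq0 -sqrf_eq0 -inner_norm.
by rewrite addrC -scaleN1r inner_linearl h mulN1r addNr.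
Qed.

(* The normal extension exists by the Riesz representation theorem:
   Pi F x is the vector with <Pi F x, y> = F (a |-> <pi a x, y>). *)
Definition rep_ext A H (pi : representation A H) : bidual A -> 'B(H, H) :=
  xget (fun=> 0) [set Pi | normal_extension pi Pi].

Definition irreducible A H (pi : representation A H) :=
  (exists a x, pi a x != 0) /\
  forall L : set H, linear_subspace L -> closed L ->
    (forall a x, L x -> L (pi a x)) -> L = [set 0] \/ L = [set: H].

Definition unitarily_equivalent A H K
    (pi : representation A H) (rho : representation A K) :=
  exists U : H -> K,
    [/\ linear U, forall x y, inner (U x) (U y) = inner x y,
        range U = [set: K] & forall a x, U (pi a x) = rho a (U x)].

(* [rho] is (unitarily equivalent to) the Hilbert space direct sum of the
   [pi i]. *)
Definition is_direct_sum A (I : Type) (H : I -> hilbertType R)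
    (pi : forall i, representation A (H i)) K (rho : representation A K) :=
  exists U : forall i, H i -> K,
    [/\ forall i, linear (U i) /\ forall x y, inner (U i x) (U i y) = inner x y,
        forall i j x y, i <> j -> inner (U i x) (U j y) = 0,
        forall L : set K, linear_subspace L -> closed L ->
          (forall i x, L (U i x)) -> L = [set: K] &
        forall i a x, U i (pi i a x) = rho a (U i x)].

Definition reduced_atomic A K (rho : representation A K) :=
  exists (I : Type) (H : I -> hilbertType R)
    (pi : forall i, representation A (H i)),
    [/\ forall i, irreducible (pi i),
        forall i j, i <> j -> ~ unitarily_equivalent (pi i) (pi j),
        forall H' (pi' : representation A H'), irreducible pi' ->
          exists i, unitarily_equivalent pi' (pi i) &
        is_direct_sum pi rho].

(* The reduced atomic representation is unique up to unitary equivalence. *)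
Definition type_U A (Y : set (bidual A)) :=
  exists K (pi_a : representation A K), reduced_atomic pi_a /\
    forall y, closure Y y -> rep_ext pi_a y = 0 -> y = 0.

Definition finite_rank H (S : 'B(H, H)) := finite_dim (range S).

(* A choice of the constants k(pi, V). *)
Definition constants A :=
  forall H, representation A H -> set H -> R.

Definition condition_K A (p1 p2 : bidual A) (X : set (bidual A))
    (k : constants A) :=
  forall H (pi : representation A H), irreducible pi ->
    rep_ext pi p1 != 0 -> rep_ext pi p2 != 0 ->
    forall V : set H, finite_dim V -> V `<=` range (rep_ext pi p2) ->
      V <> [set 0] ->
      0 < k H pi V /\
      forall t : 'B(H, H), (exists s : 'B(H, H), t =1 rep_ext pi p1 \o s) ->
        exists F, [/\ X F, normr_re F <= k H pi V * normr_re t &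
                      forall x, V x -> rep_ext pi F x = t x].

Definition constant_inf A (p2 : bidual A) (k : constants A) H
    (pi : representation A H) : R :=
  inf [set k H pi V | V in
    [set V : set H | one_dim V /\ V `<=` range (rep_ext pi p2)]].

Definition implements A (p1 : bidual A) (X : set (bidual A))
    (T : bidual A -> bidual A) H (pi : representation A H) (t : H -> H) :=
  linear_on (range (rep_ext pi p1)) t /\
  forall F, X F -> forall x, rep_ext pi (T F) x = t (rep_ext pi F x).

End representations.

(* Main.v *)
(** For an irreducible [pi] the vector functionals are multiples of pure states,
    so pure decomposability says that [pi F x = 0] implies [pi (T F) x = 0].
    Condition K prescribes the values of [pi F] at finitely many vectors of the
    range of [pi p2]; hence [pi (T F) v] depends only on [pi F v], and this
    dependence is the transformation [t]. Interpolating at one vector gives the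
    norm estimate (b). If [pi p2] has infinite rank, [X] is closed and [t] is
    unbounded, a gliding hump along an orthonormal sequence of the range of
    [pi p2] produces [F] in [X] with [pi (T F)] unbounded. Part (d) is the
    closed graph theorem: the graph of [T] is closed because each [t] is
    bounded and the atomic representation is injective on the closure of
    [T X]. *)

Require Import Defs.
From HB Require Import structures.
From mathcomp Require Import all_boot all_order all_algebra.
From mathcomp Require Import complex.
From mathcomp Require Import all_classical all_reals.
From mathcomp Require Import topology normedtype.
From mathcomp Require Import ring lra.
Set Implicit Arguments.
Unset Strict Implicit.
Unset Printing Implicit Defensive.
Import Order.TTheory GRing.Theory Num.Theory.
Import numFieldNormedType.Exports.
Local Open Scope classical_set_scope.
Local Open Scope complex_scope.
Local Open Scope ring_scope.

(** Condition K gives no bound uniform in [pi]: its constants depend on the representation and on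
    the subspace. Hence (d) cannot be read off from bounds on the individual [t], and the
    boundedness of [T] is recovered from its graph. In (c) the same dependence dictates the order of
    choices: a hump must vanish at all earlier vectors, so it interpolates on a growing subspace,
    and its size is fixed only after the constant of that subspace. When [pi p1] has finite rank,
    [t] has a finite-dimensional domain and no hump is involved.

    The preliminary that carries most of the weight is the purity of vector states in a possibly
    non-unital algebra. A positive functional below a vector functional yields a self-adjoint
    operator in the commutant, which has to be a scalar. Instead of spectral projections, Schur's
    lemma rests on an iterated square root of [T^2]. Instead of approximate units, functionals are
    compared on products only, and a Cayley transform argument shows that products determine
    them. *)

Local Notation nr := normr_re.

(** * Real-valued norms and completeness *)

Section normr_re_sequences.
Context {R : realType}.
Implicit Types V W : normedModType R[i].

Lemma nrN V (x : V) : nr (- x) = nr x.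
Proof. by rewrite /normr_re normrN. Qed.

Lemma nrBC V (x y : V) : nr (x - y) = nr (y - x).
Proof. by rewrite -nrN opprB. Qed.

Lemma nr_le_dist V (x y : V) : nr x <= nr (x - y) + nr y.
Proof. by rewrite -{1}[x](subrK y) ler_normr_reD. Qed.

Lemma nr_dist_trans V (y x z : V) : nr (x - z) <= nr (x - y) + nr (y - z).
Proof. by rewrite -{1}[x](subrK y) -addrA ler_normr_reD. Qed.

Lemma nr_gt0 V (x : V) : (0 < nr x) = (x != 0).
Proof.
rewrite lt_def normr_re_ge0 andbT.
by apply/idP/idP; apply: contra_neq; [move=> ->; rewrite normr_re0|move=> /normr_re_eq0].
Qed.

Lemma nr_real (r : R) : nr (r%:C : R[i]^o) = `|r|.
Proof.
case: (leP 0 r) => r0.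
  by rewrite ger0_norm//; apply: complexI; rewrite normr_reE ger0_norm ?ler0c.
rewrite -nrN ltr0_norm//; apply: complexI.
by rewrite normr_reE -rmorphN ger0_norm ?ler0c ?oppr_ge0 ?ltW.
Qed.

Lemma nr_scale_real V (r : R) (x : V) : 0 <= r -> nr (r%:C *: x) = r * nr x.
Proof. by move=> r0; rewrite normr_reZ nr_real ger0_norm. Qed.

Definition nr_cvg V (u : nat -> V) (l : V) :=
  forall e : R, 0 < e -> exists N, forall n, (N <= n)%N -> nr (u n - l) < e.

Definition nr_cauchy V (u : nat -> V) :=
  forall e : R, 0 < e ->
    exists N, forall m n, (N <= m)%N -> (N <= n)%N -> nr (u m - u n) < e.

Definition nr_complete V := forall u : nat -> V, nr_cauchy u ->
  exists l, nr_cvg u l.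

Lemma ge0_eps_eq0 (a C : R) : 0 <= a -> (forall e : R, 0 < e -> a <= C * e) -> a = 0.
Proof.
move=> a0 aC; apply/eqP; rewrite eq_le a0 andbT leNgt; apply/negP => agt0.
have k0 : 0 < 2 * (`|C| + 1) by rewrite mulr_gt0// ltr_wpDl.
have := aC (a / (2 * (`|C| + 1))) (divr_gt0 agt0 k0).
apply/negP; rewrite -ltNge mulrA ltr_pdivrMr// mulrC ltr_pM2l//.
have := ler_norm C; have := normr_ge0 C; lra.
Qed.

Lemma nr_cvg_unique V (u : nat -> V) l l' : nr_cvg u l -> nr_cvg u l' -> l = l'.
Proof.
move=> ul ul'; apply/eqP; rewrite -subr_eq0; apply/eqP/normr_re_eq0.
apply: (@ge0_eps_eq0 _ 2) => [|e e0]; first exact: normr_re_ge0.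
have [N uN] := ul _ e0; have [N' uN'] := ul' _ e0.
have := uN _ (leq_maxl N N'); have := uN' _ (leq_maxr N N').
have := @nr_dist_trans _ (u (maxn N N')) l l'.
rewrite (nrBC l (u _)); lra.
Qed.

Lemma nr_cvg_lip V W (f : V -> W) (C : R) (u : nat -> V) l :
  (forall x y, nr (f x - f y) <= C * nr (x - y)) ->
  nr_cvg u l -> nr_cvg (f \o u) (f l).
Proof.
move=> fC ul e e0.
have C0 : 0 < `|C| + 1 by rewrite ltr_wpDl.
have [N uN] := ul _ (divr_gt0 e0 C0); exists N => n /uN.
rewrite ltr_pdivlMr// => un; apply: le_lt_trans un.
apply: le_trans (fC _ _) _; rewrite mulrC ler_wpM2l ?normr_re_ge0//.
by rewrite (le_trans (ler_norm _))// lerDl.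
Qed.

Lemma nr_cvgD V (u v : nat -> V) l m :
  nr_cvg u l -> nr_cvg v m -> nr_cvg (fun n => u n + v n) (l + m).
Proof.
move=> ul vm e e0; have e2 : 0 < e / 2 by lra.
have [N uN] := ul _ e2; have [N' vN] := vm _ e2.
exists (maxn N N') => n; rewrite geq_max => /andP[/uN nu /vN nv].
by rewrite opprD addrACA; apply: le_lt_trans (ler_normr_reD _ _) _; lra.
Qed.

Lemma nr_cvg_cst V (l : V) : nr_cvg (fun=> l) l.
Proof. by move=> e e0; exists 0%N => n _; rewrite subrr normr_re0. Qed.

Lemma nr_cvgZ V (c : R[i]) (u : nat -> V) l :
  nr_cvg u l -> nr_cvg (fun n => c *: u n) (c *: l).
Proof.
apply: (@nr_cvg_lip _ _ _ (nr (c : R[i]^o))) => x y.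
by rewrite -scalerBr normr_reZ.
Qed.

Lemma nr_cvg_shift V (u : nat -> V) l :
  nr_cvg u l -> nr_cvg (fun n => u n.+1) l.
Proof.
by move=> ul e /ul[N uN]; exists N => n Nn; apply: uN; apply: leqW.
Qed.

Lemma nr_cvg_dist_le V (u : nat -> V) l x (C : R) N :
  nr_cvg u l -> (forall n, (N <= n)%N -> nr (u n - x) <= C) -> nr (l - x) <= C.
Proof.
move=> ul uC; apply/ler_addgt0Pr => e /ul[N' uN'].
have := uN' _ (leq_maxr N N'); have := uC _ (leq_maxl N N').
have := @nr_dist_trans _ (u (maxn N N')) l x; rewrite (nrBC l (u _)); lra.
Qed.

Lemma nr_cvg_le V (u : nat -> V) l (C : R) :
  nr_cvg u l -> (forall n, nr (u n) <= C) -> nr l <= C.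
Proof.
move=> ul uC; rewrite -[l]subr0; apply: (nr_cvg_dist_le (N := 0%N) ul) => n _.
by rewrite subr0.
Qed.

Lemma nr_telescope_le V (u : nat -> V) (b : nat -> R) :
  (forall n, nr (u n.+1 - u n) <= b n.+1 - b n) ->
  forall m n, (m <= n)%N -> nr (u n - u m) <= b n - b m.
Proof.
move=> ub m n; elim: n => [|n IH].
  by rewrite leqn0 => /eqP->; rewrite !subrr normr_re0.
rewrite leq_eqVlt => /predU1P[->|/IH mn]; first by rewrite !subrr normr_re0.
by have := ub n; have := @nr_dist_trans _ (u n) (u n.+1) (u m); lra.
Qed.

(** [b] is nondecreasing and bounded, so it comes close to its supremum and the telescoped
    increments of [u] become small. This form serves geometric series, the square root iteration and
    nested balls (with [b] the negated radii) alike. *)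
Lemma nr_cauchy_majorant V (u : nat -> V) (b : nat -> R) (M : R) :
  (forall n, nr (u n.+1 - u n) <= b n.+1 - b n) -> (forall n, b n <= M) ->
  nr_cauchy u.
Proof.
move=> ub bM e e0; pose S := range b.
have S0 : S !=set0 by exists (b 0%N), 0%N.
have hS : has_sup S by split=> //; exists M => _ [n _ <-]; exact: bM.
have [_ [N _ <-] bN] := @sup_adherent _ S (e / 2) (ltac:(lra)) hS.
have key n : (N <= n)%N -> nr (u n - u N) < e / 2.
  move=> Nn; apply: le_lt_trans (nr_telescope_le ub Nn) _.
  have : b n <= sup S by apply: ub_le_sup; [exact: hS.2|exists n].
  by lra.
exists N => m n /key um /key un.
have := @nr_dist_trans _ (u N) (u m) (u n); rewrite [nr (u N - _)]nrBC; lra.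
Qed.

Lemma completeNormedMod_nr_complete (V : completeNormedModType R[i]) :
  nr_complete V.
Proof.
move=> u cu.
(* A positive element of [R[i]] is real, so comparison with [e] is comparison with its real part. *)
have nrE (x y : V) (e : R[i]) : 0 < e -> (`|x - y| < e) = (nr (x - y) < complex.Re e).
  by case: e => a b; rewrite ltcE/= => /andP[/eqP-> _]; rewrite -normr_reE ltcE/= eqxx.
have ReC (e : R[i]) : 0 < e -> 0 < complex.Re e by rewrite ltcE => /andP[].
have : cauchy (u @ \oo).
  apply: cauchy_exP => e e0; have [N uN] := cu _ (ReC _ e0).
  exists (u N); exists N => // n Nn.
  by rewrite /= -ball_normE /= nrE//; apply: uN.
move=> /cauchy_cvgP /cvg_ex[l ul]; exists l => e e0.
have /cvgrPdist_lt/(_ e%:C) := ul; rewrite ltcR => /(_ e0) [N _ uN].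
by exists N => n /uN; rewrite /= nrE ?ltcR// nrBC.
Qed.

Lemma closure_nrP V (X : set V) x :
  closure X x <-> forall e : R, 0 < e -> exists2 y, X y & nr (y - x) < e.
Proof.
split=> [Xx e e0|Xx B /nbhs_ballP[e e0 eB]].
  have [y [Xy]] := Xx _ (@nbhsx_ballx _ _ x e%:C (ltac:(by rewrite ltcR))).
  rewrite -ball_normE /= -normr_reE ltcR => xy.
  by exists y => //; rewrite nrBC.
have /Xx[y Xy xy] : 0 < complex.Re e by move: e0; rewrite /= ltcE => /andP[].
exists y; split=> //; apply: eB; rewrite -ball_normE /= -normr_reE.
move: e0 xy; clear; case: e => a b /=; by rewrite !ltcE/= nrBC => /andP[-> _].
Qed.

Lemma closed_nrP V (X : set V) : closed X <->
  forall x, (forall e : R, 0 < e -> exists2 y, X y & nr (y - x) < e) -> X x.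
Proof.
split=> [cX x|cX x /closure_nrP]; first by move/closure_nrP; apply: cX.
exact: cX.
Qed.

Lemma closed_nr_cvg V (X : set V) u l :
  closed X -> (forall n, X (u n)) -> nr_cvg u l -> X l.
Proof.
move=> /closed_nrP cX Xu ul; apply: cX => e /ul[N uN].
by exists (u N) => //; exact: uN.
Qed.

Lemma closed_ker V W (g : V -> W) (C : R) :
  (forall x y, nr (g x - g y) <= C * nr (x - y)) -> closed [set x | g x = 0].
Proof.
move=> gC; apply/closed_nrP => x xe; apply: normr_re_eq0.
have C0 : 0 <= `|C| by [].
apply: (@ge0_eps_eq0 _ `|C|) => [|e /xe[y gy xy]]; first exact: normr_re_ge0.
have := gC x y; rewrite gy subr0 nrBC => /le_trans->//.
apply: (@le_trans _ _ (`|C| * nr (y - x))).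
  by rewrite ler_wpM2r ?normr_re_ge0// ler_norm.
by rewrite ler_wpM2l// ltW.
Qed.

Lemma closed_common_ker (I : Type) V W (g : I -> V -> W)
    (C : I -> R) : (forall i x y, nr (g i x - g i y) <= C i * nr (x - y)) ->
  closed [set x | forall i, g i x = 0].
Proof.
move=> gC; apply/closed_nrP => x xe i.
have /closed_nrP := closed_ker (gC i); apply=> e /xe[y gy xy].
by exists y => //=; exact: gy.
Qed.

End normr_re_sequences.

(** * Real parts, moduli and completeness of the complex scalars *)

Section complex_scalars.
Context {R : realType}.
Implicit Types z w : R[i].

Lemma ReD z w : complex.Re (z + w) = complex.Re z + complex.Re w.
Proof. by case: z w => [a b] []. Qed.

Lemma ReN z : complex.Re (- z) = - complex.Re z.
Proof. by case: z. Qed.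

Lemma ReB z w : complex.Re (z - w) = complex.Re z - complex.Re w.
Proof. by rewrite ReD ReN. Qed.

Lemma ReZ (r : R) z : complex.Re (r%:C * z) = r * complex.Re z.
Proof. by case: z => a b /=; rewrite mul0r subr0. Qed.

Lemma Re_conj z : complex.Re (z^*)%R = complex.Re z.
Proof. by case: z. Qed.

Lemma Re_mul_i z : complex.Re ('i%C * z) = - complex.Im z.
Proof. by case: z => a b /=; rewrite mul0r mul1r add0r. Qed.

Lemma complex_ext z w :
  complex.Re z = complex.Re w -> complex.Im z = complex.Im w -> z = w.
Proof. by case: z w => [a b] [c d] /= -> ->. Qed.

Lemma nr_complex_sqr z :
  nr (z : R[i]^o) ^+ 2 = complex.Re z ^+ 2 + complex.Im z ^+ 2.
Proof. by apply: complexI; rewrite add_Re2_Im2 rmorphXn /= normr_reE. Qed.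

Lemma normr_Re_le z : `|complex.Re z| <= nr (z : R[i]^o).
Proof.
rewrite -ler_sqr ?nnegrE ?normr_re_ge0//.
by rewrite real_normK ?num_real// nr_complex_sqr lerDl sqr_ge0.
Qed.

Lemma Re_le_nr z : complex.Re z <= nr (z : R[i]^o).
Proof. exact: le_trans (ler_norm _) (normr_Re_le z). Qed.

Lemma nr_complexM z w : nr (z * w : R[i]^o) = nr (z : R[i]^o) * nr (w : R[i]^o).
Proof. by rewrite -normr_reZ. Qed.

Lemma complex_nr_complete : nr_complete (R[i]^o : normedModType R[i]).
Proof.
move=> u cu.
have part (f : R[i] -> R) : (forall z w, `|f z - f w| <= nr (z - w : R[i]^o)) ->
    exists l, forall e : R, 0 < e -> exists N, forall n, (N <= n)%N -> `|f (u n) - l| < e.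
  move=> flip; have : cauchy ((f \o u) @ \oo).
    apply: cauchy_exP => e e0; have [N uN] := cu _ e0.
    exists (f (u N)); exists N => // n Nn; rewrite /= -ball_normE /=.
    by apply: le_lt_trans (flip _ _) _; apply: uN.
  move=> /cauchy_cvgP /cvg_ex[l fl]; exists l => e e0.
  have /cvgrPdist_lt/(_ e e0)[N _ fN] := fl.
  by exists N => n /fN /=; rewrite distrC.
have sqlip (z : R[i]) (a : R) : a ^+ 2 <= nr (z : R[i]^o) ^+ 2 -> `|a| <= nr (z : R[i]^o).
  by rewrite -[a ^+ 2]real_normK ?num_real// ler_sqr ?nnegrE ?normr_re_ge0.
have Re_lip z w : `|complex.Re z - complex.Re w| <= nr (z - w : R[i]^o).
  by apply: sqlip; rewrite -ReB nr_complex_sqr lerDl sqr_ge0.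
have [a ua] := part _ Re_lip.
have ImB z w : complex.Im (z - w) = complex.Im z - complex.Im w.
  by case: z w => [? ?] [].
have Im_lip z w : `|complex.Im z - complex.Im w| <= nr (z - w : R[i]^o).
  by apply: sqlip; rewrite -ImB nr_complex_sqr lerDr sqr_ge0.
have [b ub] := part _ Im_lip.
exists (a +i* b) => e e0; have e2 : 0 < e / 2 by lra.
have [N uN] := ua _ e2; have [N' uN'] := ub _ e2; exists (maxn N N') => n.
rewrite geq_max => /andP[/uN n1 /uN' n2].
rewrite -ltr_sqr ?nnegrE ?normr_re_ge0 ?(ltW e0)// nr_complex_sqr ReB ImB /=.
rewrite -[X in X + _]real_normK ?num_real// -[X in _ + X]real_normK ?num_real//.
have := normr_ge0 (complex.Re (u n) - a); have := normr_ge0 (complex.Im (u n) - b).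
nra.
Qed.

End complex_scalars.

(** * Completeness of spaces of bounded operators *)

Section blin_complete.
Context {R : realType} {V W : normedModType R[i]}.

Lemma blin_app0 (f : 'B(V, W)) : f 0 = 0. Proof. exact: linear0. Qed.

Lemma blin_appD (f : 'B(V, W)) x y : f (x + y) = f x + f y.
Proof. exact: linearD. Qed.

Lemma blin_appB (f : 'B(V, W)) x y : f (x - y) = f x - f y.
Proof. exact: linearB. Qed.

Lemma blin_appZ (f : 'B(V, W)) c x : f (c *: x) = c *: f x.
Proof. exact: linearZ. Qed.

Lemma nr_blin_le_pt (f : 'B(V, W)) (C : R) : 0 <= C ->
  (forall x, nr (f x) <= C * nr x) -> nr f <= C.
Proof.
move=> C0 fC; apply: opnorm_le => x x1; apply: le_trans (fC x) _.
by rewrite ler_piMr.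
Qed.

(** The pointwise limit is also the norm limit, because the Cauchy estimate survives letting one
    index tend to infinity. Applied twice from the scalars, this makes the bidual complete. *)
Lemma blin_nr_complete : nr_complete W -> nr_complete 'B(V, W).
Proof.
move=> cW u cu.
have ptB m n x : nr (u m x - u n x) <= nr (u m - u n) * nr x.
  by rewrite -blinNE -blinDE blin_le.
have pt x : exists l, nr_cvg (fun n => u n x) l.
  apply: cW => e e0; have x1 : 0 < nr x + 1 by rewrite ltr_wpDl ?normr_re_ge0.
  have [N uN] := cu _ (divr_gt0 e0 x1); exists N => m n Nm Nn.
  have := uN m n Nm Nn; rewrite ltr_pdivlMr// => /le_lt_trans-> //.
  by rewrite (le_trans (ptB _ _ _))// ler_wpM2l ?normr_re_ge0// lerDl.
have [g gP] := choice pt.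
have gl : linear g.
  move=> c x y; apply: nr_cvg_unique (gP _) _.
  rewrite (_ : (fun n => _) = fun n => c *: u n x + u n y).
    exact: nr_cvgD (nr_cvgZ c (gP x)) (gP y).
  by apply/funext => n; rewrite linearP.
have near (e : R) : 0 < e -> exists N, forall n, (N <= n)%N ->
    forall x, nr (u n x - g x) <= e * nr x.
  move=> e0; have [N uN] := cu _ e0; exists N => n Nn x.
  rewrite nrBC; apply: (nr_cvg_dist_le (N := N) (gP x)) => m Nm.
  by rewrite (le_trans (ptB _ _ _))// ler_wpM2r ?normr_re_ge0// ltW// uN.
have gb : bounded_on [set: V] g.
  have [N uN] := near 1 ltr01; exists (1 + nr (u N)) => x _.
  rewrite (le_trans (nr_le_dist _ (u N x)))// mulrDl lerD ?blin_le//.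
  by rewrite nrBC uN.
exists (BLin gl gb) => e e0; have e2 : 0 < e / 2 by lra.
have [N uN] := near _ e2; exists N => n Nn.
apply: (@le_lt_trans _ _ (e / 2)); last lra.
by apply: nr_blin_le_pt (ltW e2) _ => x; exact: uN.
Qed.

End blin_complete.

(** * Hilbert spaces *)

Section positive_forms.
Context {R : realType} {V : lmodType R[i]} (B : V -> V -> R[i]).
Hypothesis Bl : forall c x y z, B (c *: x + y) z = c * B x z + B y z.
Hypothesis Br : forall c x y z, B z (c *: x + y) = (c^*)%R * B z x + B z y.
Hypothesis B_ge0 : forall x, 0 <= B x x.

(** Polarization: the form is real at [x + y] and at [i x + y], which gives the imaginary and the
    real part of the identity. *)
Lemma positive_form_hermitian x y : B y x = ((B x y)^*)%R.
Proof.
have im0 z : complex.Im (B z z) = 0.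
  by have := B_ge0 z; rewrite lecE => /andP[/eqP].
have B1 : B (1 *: x + y) (1 *: x + y) = B x x + B x y + B y x + B y y.
  by rewrite Bl !Br conjC1 !mul1r addrA.
have Bi : B ('i%C *: x + y) ('i%C *: x + y)
    = B x x + 'i%C * B x y - 'i%C * B y x + B y y.
  rewrite Bl !Br; have -> : ('i%C^*)%R = - 'i%C :> R[i].
    by apply: complex_ext; rewrite /= ?oppr0.
  by rewrite mulrDr mulrA mulrN -expr2 sqr_i opprK mul1r mulNr addrA.
have := im0 (1 *: x + y); have := im0 ('i%C *: x + y); rewrite {}B1 {}Bi.
have := im0 x; have := im0 y.
case: (B x x) (B x y) (B y x) (B y y) => [a1 a2] [b1 b2] [c1 c2] [d1 d2] /=.
by move=> ? ? ? ?; apply: complex_ext => /=; lra.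
Qed.

Lemma positive_form_cs x y :
  nr (B x y : R[i]^o) ^+ 2 <= complex.Re (B x x) * complex.Re (B y y).
Proof.
set b := B x y; set n2 := nr (b : R[i]^o) ^+ 2.
(* This is the value of the form at [x - t b y]; the optimal [t] is the inverse of [B y y]. *)
have key (t : R) : 0 <= complex.Re (B x x) - 2 * t * n2 + t ^+ 2 * n2 * complex.Re (B y y).
  have : 0 <= complex.Re (B ((- (t%:C * b)) *: y + x) ((- (t%:C * b)) *: y + x)).
    by have := B_ge0 ((- (t%:C * b)) *: y + x); rewrite lecE => /andP[].
  congr (0 <= _); rewrite Bl !Br (positive_form_hermitian x y) -/b /n2 nr_complex_sqr.
  have := B_ge0 y; rewrite lecE => /andP[/eqP/=].
  rewrite /b; case: (B y y) (B x y) (B x x) => [d1 d2] [b1 b2] [a1 a2] /= -> _; ring.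
have n0 : 0 <= n2 by rewrite sqr_ge0.
have : 0 <= complex.Re (B y y) by have := B_ge0 y; rewrite lecE => /andP[].
rewrite le_eqVlt => /predU1P[d0|d0].
  rewrite -d0 mulr0 leNgt; apply/negP => n_gt0.
  (* With [B y y = 0] the expression is affine in [t], and this [t] gives it the value [-1]. *)
  have := key ((complex.Re (B x x) + 1) / (2 * n2)); rewrite -d0 mulr0 addr0.
  have -> : 2 * ((complex.Re (B x x) + 1) / (2 * n2)) * n2 = complex.Re (B x x) + 1.
    by field; rewrite gt_eqF.
  lra.
have := key (complex.Re (B y y))^-1.
set d := complex.Re (B y y) in d0 *.
have -> : complex.Re (B x x) - 2 * d^-1 * n2 + d^-1 ^+ 2 * n2 * d
    = (complex.Re (B x x) * d - n2) / d by field; rewrite gt_eqF.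
by rewrite pmulr_lge0 ?invr_gt0// subr_ge0.
Qed.

End positive_forms.

Section hilbert.
Context {R : realType} {H : hilbertType R}.
Implicit Types x y z : H.

Lemma innerDl x y z : inner (x + y) z = inner x z + inner y z.
Proof. by rewrite -{1}[x]scale1r inner_linearl mul1r. Qed.

Lemma inner0l z : inner (0 : H) z = 0.
Proof. by apply: (addrI (inner 0 z)); rewrite -innerDl !addr0. Qed.

Lemma innerZl (c : R[i]) x z : inner (c *: x) z = c * inner x z.
Proof. by rewrite -[c *: x]addr0 inner_linearl inner0l addr0. Qed.

Lemma innerNl x z : inner (- x) z = - inner x z.
Proof. by rewrite -scaleN1r innerZl mulN1r. Qed.

Lemma innerBl x y z : inner (x - y) z = inner x z - inner y z.
Proof. by rewrite innerDl innerNl. Qed.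

Lemma inner_linearr (c : R[i]) x y z :
  inner z (c *: x + y) = (c^*)%R * inner z x + inner z y.
Proof. by rewrite inner_conj inner_linearl rmorphD rmorphM /= -!inner_conj. Qed.

Lemma innerDr x y z : inner z (x + y) = inner z x + inner z y.
Proof. by rewrite inner_conj innerDl rmorphD /= -!inner_conj. Qed.

Lemma innerZr (c : R[i]) x z : inner z (c *: x) = (c^*)%R * inner z x.
Proof. by rewrite inner_conj innerZl rmorphM /= -inner_conj. Qed.

Lemma innerNr x z : inner z (- x) = - inner z x.
Proof. by rewrite inner_conj innerNl rmorphN /= -inner_conj. Qed.

Lemma innerBr x y z : inner z (x - y) = inner z x - inner z y.
Proof. by rewrite innerDr innerNr. Qed.

Lemma inner_xx x : inner x x = (nr x ^+ 2)%:C.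
Proof. by rewrite inner_norm rmorphXn /= normr_reE. Qed.

Lemma Re_inner_xx x : complex.Re (inner x x) = nr x ^+ 2.
Proof. by rewrite inner_xx. Qed.

Lemma inner_xx_eq0 x : inner x x = 0 -> x = 0.
Proof.
rewrite inner_xx => /(@complexI R _ 0) x0; apply: normr_re_eq0.
by apply/eqP; rewrite -sqrf_eq0 x0.
Qed.

Lemma inner_ext x y : (forall z, inner x z = inner y z) -> x = y.
Proof.
move=> xy; apply/eqP; rewrite -subr_eq0; apply/eqP/inner_xx_eq0.
by rewrite innerBl xy subrr.
Qed.

Lemma inner_ge0 x : 0 <= inner x x.
Proof. by rewrite inner_xx ler0c sqr_ge0. Qed.

Lemma nr_inner_le x y : nr (inner x y : R[i]^o) <= nr x * nr y.
Proof.
rewrite -ler_sqr ?nnegrE ?mulr_ge0 ?normr_re_ge0// exprMn -!Re_inner_xx.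
apply: positive_form_cs; first exact: inner_linearl.
  by move=> *; exact: inner_linearr.
exact: inner_ge0.
Qed.

Lemma Re_inner_le x y : complex.Re (inner x y) <= nr x * nr y.
Proof. exact: le_trans (Re_le_nr _) (nr_inner_le _ _). Qed.

Lemma nr_sqrD x y :
  nr (x + y) ^+ 2 = nr x ^+ 2 + 2 * complex.Re (inner x y) + nr y ^+ 2.
Proof.
rewrite -Re_inner_xx innerDl !innerDr !ReD (inner_conj x y) Re_conj !Re_inner_xx.
ring.
Qed.

Lemma nr_sqrB x y :
  nr (x - y) ^+ 2 = nr x ^+ 2 - 2 * complex.Re (inner x y) + nr y ^+ 2.
Proof. by rewrite nr_sqrD innerNr ReN nrN mulrN. Qed.

(* [J = id] is the usual Riesz theorem; a general [J] spares the extension of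
   functionals from dense subspaces. The vector is the limit of [J b] along a
   minimizing sequence of [|J b|^2 - 2 Re (l b)]. *)
Lemma riesz (V : lmodType R[i]) (J : V -> H) (l : V -> R[i]) (C : R) :
  linear J -> linear (l : V -> R[i]^o) -> 0 <= C ->
  (forall b, nr (l b : R[i]^o) <= C * nr (J b)) ->
  exists2 z, (forall b, l b = inner (J b) z) & nr z <= C.
Proof.
move=> Jl ll C0 lC.
have JD b c : J (b + c) = J b + J c by rewrite -{1}[b]scale1r Jl scale1r.
have lD b c : l (b + c) = l b + l c by have := ll 1 b c; rewrite !scale1r.
have J0 : J 0 = 0 by apply: (addrI (J 0)); rewrite -JD !addr0.
have l0 : l 0 = 0 by apply: (addrI (l 0)); rewrite -lD !addr0.
have JZ c b : J (c *: b) = c *: J b by rewrite -[c *: b]addr0 Jl J0 addr0.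
have lZ c b : l (c *: b) = c * l b.
  by have := ll c b 0; rewrite addr0 l0 addr0.
pose q b := nr (J b) ^+ 2 - 2 * complex.Re (l b).
have qC b : - C ^+ 2 <= q b.
  have := le_trans (Re_le_nr _) (lC b); rewrite /q.
  have := sqr_ge0 (nr (J b) - C); nra.
pose m := inf (range q).
have hq : has_inf (range q).
  by split; [exists (q 0), 0|exists (- C ^+ 2) => _ [b _ <-]].
have mq b : m <= q b by apply: ge_inf; [exact: hq.2|exists b].
have min_seq n : exists b : V, q b < m + n.+1%:R^-1.
  have [|_ [b _ <-] qb] := @inf_adherent _ _ n.+1%:R^-1 _ hq; last by exists b.
  by rewrite invr_gt0 ltr0Sn.
have [b bP] := choice min_seq.
(* The parallelogram identity: near-minimality of [q] at [c] and [d] forces [J c] and [J d] to be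
   close, since [q] at the midpoint is at least [m]. *)
have qpar c d : nr (J c - J d) ^+ 2 = 2 * q c + 2 * q d - 4 * q ((2^-1)%:C *: (c + d)).
  rewrite /q JZ lZ ReZ nr_scale_real ?invr_ge0 ?ler0n// JD lD ReD exprMn nr_sqrB nr_sqrD.
  by field.
have small (e : R) : 0 < e -> exists N, forall n, (N <= n)%N -> n.+1%:R^-1 < e.
  move=> e0; exists (Num.truncn e^-1) => n Nn.
  rewrite invf_plt ?posrE// (lt_le_trans (truncnS_gt _))//.
  by rewrite ler_nat ltnS.
have [z Jz] : exists z, nr_cvg (J \o b) z.
  apply: completeNormedMod_nr_complete => e e0.
  have [N sN] := small (e ^+ 2 / 4) (ltac:(nra)); exists N => i j Ni Nj /=.
  rewrite -ltr_sqr ?nnegrE ?normr_re_ge0 ?(ltW e0)// qpar.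
  have := mq ((2^-1)%:C *: (b i + b j)).
  move: (bP i) (bP j) (sN _ Ni) (sN _ Nj).
  by move: (i.+1%:R^-1) (j.+1%:R^-1) => ri rj; lra.
(* Compare [q (b n + s c)], which is at least [m], with [q (b n)] and let [n] grow. The inequality
   concerns only the limit [z]; a minimizer in [V] need not exist. *)
have var c (s : R) :
    0 <= 2 * s * (complex.Re (inner z (J c)) - complex.Re (l c)) + s ^+ 2 * nr (J c) ^+ 2.
  apply/ler_addgt0Pr => e e0.
  have e2 : 0 < e / 2 by lra.
  have k0 : 0 < 2 * `|s| * nr (J c) + 1.
    by rewrite ltr_wpDl// !mulr_ge0// normr_re_ge0.
  have [N sN] := small _ e2; have [N' zN] := Jz _ (divr_gt0 e2 k0).
  have := bP (maxn N N'); have := sN _ (leq_maxl N N').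
  have := zN _ (leq_maxr N N'); rewrite /=; set d := b (maxn N N').
  have := mq (d + s%:C *: c); rewrite /q JD lD JZ lZ ReD ReZ nr_sqrD innerZr.
  rewrite conj_Creal ?ReZ; last by rewrite complex_real.
  have -> : nr (s%:C *: J c) ^+ 2 = s ^+ 2 * nr (J c) ^+ 2.
    by rewrite normr_reZ nr_real exprMn real_normK ?num_real.
  have : s * complex.Re (inner (J d - z) (J c)) <= `|s| * (nr (J d - z) * nr (J c)).
    rewrite (le_trans (ler_norm _))// normrM ler_wpM2l//.
    exact: le_trans (normr_Re_le _) (nr_inner_le _ _).
  rewrite innerBl ReB ltr_pdivlMr//.
  have := normr_re_ge0 (J d - z); move: ((maxn N N').+1%:R^-1 : R) => r.
  move: (complex.Re (inner (J d) _)) (complex.Re (inner z _)) => x1 x2.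
  move: (complex.Re (l c)) (complex.Re (l d)) => x3 x4.
  move: (`|s| : R) (nr (J c)) (nr (J d - z)) (nr (J d) ^+ 2) => y1 y2 y3 y4.
  move: e0; clear; nra.
have Re_eq c : complex.Re (l c) = complex.Re (inner z (J c)).
  set K := nr (J c) ^+ 2; set D := complex.Re (inner z (J c)) - complex.Re (l c).
  suff : D = 0 by rewrite /D; lra.
  have K1 : 0 < K + 1 by rewrite ltr_wpDl// sqr_ge0.
  (* The denominator is [K + 1] rather than [K], because [J c] may be zero. *)
  have := var c (- D / (K + 1)); rewrite -/K -/D.
  have -> : 2 * (- D / (K + 1)) * D + (- D / (K + 1)) ^+ 2 * K
      = - (D ^+ 2 * (K + 2)) / (K + 1) ^+ 2 by field; rewrite gt_eqF.
  rewrite pmulr_lge0 ?invr_gt0 ?exprn_gt0// oppr_ge0.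
  rewrite pmulr_lle0; last lra.
  by move=> D0; apply/eqP; rewrite -sqrf_eq0 eq_le D0 sqr_ge0.
have lz c : l c = inner (J c) z.
  rewrite (inner_conj z); apply: complex_ext; first by rewrite Re_conj Re_eq.
  have := Re_eq ('i%C *: c); rewrite lZ JZ innerZr Re_mul_i.
  by case: (l c) (inner z (J c)) => [l1 l2] [i1 i2] /=; lra.
exists z => //; rewrite leNgt; apply/negP => Cz.
have z0 : 0 < nr z by apply: le_lt_trans C0 Cz.
(* [l (b n)] tends to [|z|^2], while it is at most [C |J (b n)|], which tends to [C |z|]. *)
suff : (nr z - C) * nr z = 0.
  by move/eqP; rewrite mulf_eq0 subr_eq0 !gt_eqF.
apply: (@ge0_eps_eq0 _ _ (nr z + C)) => [|e e0].
  by rewrite mulr_ge0 ?subr_ge0 ?ltW.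
have [N /(_ N (leqnn N)) /= Jb] := Jz _ e0.
have := le_trans (Re_le_nr _) (lC (b N)); rewrite lz.
have := Re_inner_le (z - J (b N)) z; rewrite innerBl ReB Re_inner_xx.
have := nr_le_dist (J (b N)) z; rewrite (nrBC z); nra.
Qed.

End hilbert.

(** * Representations and their normal extensions *)

Section cstar_algebra.
Context {R : realType} {A : cstarAlgType R}.
Implicit Types a b c : A.

Lemma cmulDl a b c : cmul (a + b) c = cmul a c + cmul b c.
Proof. by rewrite -{1}[a]scale1r cmul_linearl scale1r. Qed.

Lemma cmulDr a b c : cmul c (a + b) = cmul c a + cmul c b.
Proof. by rewrite -{1}[a]scale1r cmul_linearr scale1r. Qed.

Lemma cmul0l c : cmul 0 c = 0 :> A.
Proof. by apply: (addrI (cmul 0 c)); rewrite -cmulDl !addr0. Qed.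

Lemma cmul0r c : cmul c 0 = 0 :> A.
Proof. by apply: (addrI (cmul c 0)); rewrite -cmulDr !addr0. Qed.

Lemma cmulZl (k : R[i]) a c : cmul (k *: a) c = k *: cmul a c.
Proof. by rewrite -[k *: a]addr0 cmul_linearl cmul0l addr0. Qed.

Lemma cmulZr (k : R[i]) a c : cmul c (k *: a) = k *: cmul c a.
Proof. by rewrite -[k *: a]addr0 cmul_linearr cmul0r addr0. Qed.

Lemma cmulNl a c : cmul (- a) c = - cmul a c.
Proof. by rewrite -scaleN1r cmulZl scaleN1r. Qed.

Lemma cmulNr a c : cmul c (- a) = - cmul c a.
Proof. by rewrite -scaleN1r cmulZr scaleN1r. Qed.

Lemma cstarD a b : cstar (a + b) = cstar a + cstar b.
Proof. by rewrite -{1}[a]scale1r cstar_semilinear conjC1 scale1r. Qed.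

Lemma cstar0 : cstar (0 : A) = 0.
Proof. by apply: (addrI (cstar 0)); rewrite -cstarD !addr0. Qed.

Lemma cstarZ (k : R[i]) a : cstar (k *: a) = (k^*)%R *: cstar a.
Proof. by rewrite -[k *: a]addr0 cstar_semilinear cstar0 addr0. Qed.

Lemma cstarN a : cstar (- a) = - cstar a.
Proof. by apply: (addrI (cstar a)); rewrite -cstarD !subrr cstar0. Qed.

Lemma nr_cstar_cmul a : nr (cmul (cstar a) a) = nr a ^+ 2.
Proof. by apply: complexI; rewrite rmorphXn /= !normr_reE normr_cstar_cmul. Qed.

End cstar_algebra.

(** If [p / q = 1 + x] with [x > 0], Bernoulli's inequality would keep every [n x] below [M]. *)
Lemma le_of_pow2_le (R : realType) (p q M : R) : 0 <= p -> 0 <= q ->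
  (forall n, p ^+ (2 ^ n) <= M * q ^+ (2 ^ n)) -> p <= q.
Proof.
move=> p0; rewrite le_eqVlt => /predU1P[<- pq|q0 pq].
  by have := pq 0%N; rewrite !expr1 mulr0.
rewrite leNgt; apply/negP => qp.
have bern (x : R) n : 0 <= x -> 1 + n%:R * x <= (1 + x) ^+ n.
  move=> x0; elim: n => [|n IH]; first by rewrite expr0 mul0r addr0.
  rewrite exprS -natr1; have : 0 <= n%:R * x by rewrite mulr_ge0.
  by move: IH; move: (n%:R : R) => k; nra.
set x := p / q - 1.
have x0 : 0 < x by rewrite subr_gt0 ltr_pdivlMr// mul1r.
have xM n : n%:R * x <= M.
  apply: (@le_trans _ _ ((1 + x) ^+ (2 ^ n))).
    apply: le_trans (bern _ _ (ltW x0)).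
    rewrite (@le_trans _ _ ((2 ^ n)%:R * x))//; last by rewrite lerDr.
    by rewrite ler_wpM2r ?(ltW x0)// ler_nat ltnW// ltn_expl.
  by rewrite addrC subrK expr_div_n ler_pdivrMr ?exprn_gt0.
have := xM (Num.truncn (M / x)).+1; rewrite leNgt => /negP; apply.
by rewrite -ltr_pdivrMr// truncnS_gt.
Qed.

Section representations.
Context {R : realType} {A : cstarAlgType R} {H : hilbertType R}.
Variable pi : representation A H.
Implicit Types (F G : bidual A) (x y : H).

Lemma rep_adjoint a x y : inner (pi a x) y = inner x (pi (cstar a) y).
Proof. by rewrite -(rep_star pi) cstarK. Qed.

(** Only some bound [|pi|] is known at first. The C*-identity doubles exponents, so
    [|pi a|^(2^n) <= |pi| |a|^(2^n)], and the constant disappears in the limit. *)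
Lemma rep_contractive a : nr (pi a) <= nr a.
Proof.
have sq b : nr (pi b) ^+ 2 <= nr (pi (cmul (cstar b) b)).
  set r := nr (pi (cmul _ _)); have r0 : 0 <= r by exact: normr_re_ge0.
  rewrite -[r]sqr_sqrtr// ler_sqr ?nnegrE ?normr_re_ge0 ?sqrtr_ge0//.
  apply: nr_blin_le_pt; first exact: sqrtr_ge0.
  move=> x; rewrite -ler_sqr ?nnegrE ?mulr_ge0 ?normr_re_ge0 ?sqrtr_ge0//.
  rewrite exprMn sqr_sqrtr// -Re_inner_xx rep_adjoint inner_conj Re_conj -rep_mul.
  apply: le_trans (Re_inner_le _ _) _.
  by rewrite expr2 mulrA ler_wpM2r ?normr_re_ge0// blin_le.
apply: (@le_of_pow2_le _ _ _ (nr (rep_fun pi))) => [||n]; rewrite ?normr_re_ge0//.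
elim: n a => [|n IH] a; first by rewrite !expr1 blin_le.
rewrite expnS exprM (le_trans (lerXn2r (2 ^ n) _ _ (sq a))) ?nnegrE ?sqr_ge0//.
  exact: normr_re_ge0.
by apply: le_trans (IH _) _; rewrite nr_cstar_cmul -exprM.
Qed.

Lemma rep_coef_le a x y :
  nr (inner (pi a x) y : R[i]^o) <= nr x * nr y * nr a.
Proof.
apply: le_trans (nr_inner_le _ _) _; rewrite mulrAC ler_wpM2r ?normr_re_ge0//.
apply: le_trans (blin_le _ _) _.
by rewrite mulrC ler_wpM2l ?normr_re_ge0// rep_contractive.
Qed.

Fact coef_subproof x y :
  linear (fun a => inner (pi a x) y : R[i]^o) /\
  bounded_on [set: A] (fun a => inner (pi a x) y : R[i]^o).
Proof.
split=> [c a b|]; first by rewrite linearP inner_linearl.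
by exists (nr x * nr y) => a _; exact: rep_coef_le.
Qed.

Definition coef x y : dual A := blin_of (coef_subproof x y).

Lemma coef_le x y : nr (coef x y) <= nr x * nr y.
Proof.
apply: nr_blin_le_pt => [|a]; first by rewrite mulr_ge0 ?normr_re_ge0.
exact: rep_coef_le.
Qed.

Lemma rep_ext_normal : normal_extension pi (rep_ext pi).
Proof.
apply: (@xgetPex _ (fun=> 0) [set Pi | normal_extension pi Pi]).
have vec F x : exists2 z, (forall y, inner z y = F (coef x y)) & nr z <= nr F * nr x.
  (* [coef x y] is conjugate-linear in [y], so the functional to represent is the conjugate of
     [F (coef x y)]. *)
  have [||||z Fz zF] := @riesz _ H _ idfun (fun y => (F (coef x y))^*%R) (nr F * nr x).
  - by [].
  - move=> c y z; have -> : coef x (c *: y + z) = (c^*)%R *: coef x y + coef x z.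
      by apply/blinP => a /=; rewrite inner_linearr.
    by rewrite linearP rmorphD rmorphM /= conjCK.
  - by rewrite mulr_ge0 ?normr_re_ge0.
  - move=> y; rewrite normr_re_conj; apply: le_trans (blin_le _ _) _.
    by rewrite -mulrA ler_wpM2l ?normr_re_ge0// coef_le.
  by exists z => // y; rewrite inner_conj -Fz conjCK.
have op F : exists f : 'B(H, H), forall x y, inner (f x) y = F (coef x y).
  have /choice[f fP] x : exists z, (forall y, inner z y = F (coef x y)) /\ nr z <= nr F * nr x.
    by have [z] := vec F x; exists z.
  have fl : linear f.
    move=> c x y; apply: inner_ext => z; rewrite inner_linearl !(fP _).1.
    rewrite -[_ * _ + _]/(c *: (F (coef x z) : R[i]^o) + F (coef y z)) -linearP.
    by congr (F _); apply/blinP => a /=; rewrite linearP inner_linearl.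
  have fb : bounded_on [set: H] f by exists (nr F) => x _; exact: (fP x).2.
  by exists (BLin fl fb) => x y; exact: (fP x).1.
have [Pi PiP] := choice op; exists Pi; split=> [x y|a].
  by exists (coef x y) => F; rewrite PiP.
by apply/blinP => x; apply: inner_ext => y; rewrite PiP.
Qed.

Lemma rep_ext_coef F x y : inner (rep_ext pi F x) y = F (coef x y).
Proof.
have [/(_ x y)[f Ff] ext] := rep_ext_normal; rewrite Ff; congr (F _).
by apply/blinP => a; rewrite -[f a](Ff (beval a)) ext.
Qed.

Lemma rep_ext_linear (c : R[i]) F G :
  rep_ext pi (c *: F + G) = c *: rep_ext pi F + rep_ext pi G.
Proof.
apply/blinP => x; apply: inner_ext => y.
by rewrite blinDE blinZE inner_linearl !rep_ext_coef.
Qed.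

Lemma rep_extB F G x : rep_ext pi (F - G) x = rep_ext pi F x - rep_ext pi G x.
Proof. by rewrite addrC -scaleN1r rep_ext_linear blinDE blinZE scaleN1r addrC. Qed.

Lemma rep_ext0 : rep_ext pi 0 = 0.
Proof. by apply/blinP => x; rewrite -(subrr 0) rep_extB subrr. Qed.

Lemma rep_ext_le F x : nr (rep_ext pi F x) <= nr F * nr x.
Proof.
set z := rep_ext pi F x.
have [->|z0] := eqVneq z 0; first by rewrite normr_re0 mulr_ge0 ?normr_re_ge0.
have zgt0 : 0 < nr z by rewrite nr_gt0.
rewrite -(ler_pM2r zgt0) -expr2 -Re_inner_xx {1}/z rep_ext_coef.
apply: le_trans (Re_le_nr _) _; apply: le_trans (blin_le _ _) _.
by rewrite -mulrA ler_wpM2l ?normr_re_ge0// coef_le.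
Qed.

(** Acting by [a] on [coef x y] moves [pi (cstar a)] onto the second vector, so both stages of the
    Arens product stay among the matrix coefficients. *)
Lemma rep_ext_bmul F G x :
  rep_ext pi (bmul F G) x = rep_ext pi F (rep_ext pi G x).
Proof.
apply: inner_ext => y; rewrite !rep_ext_coef /=; congr (F _); apply/blinP => a /=.
have -> : dual_act (coef x y) a = coef x (pi (cstar a) y).
  by apply/blinP => b /=; rewrite rep_mul rep_adjoint.
by rewrite -rep_ext_coef -rep_adjoint.
Qed.

Lemma rep_ext_bstar F x y :
  inner (rep_ext pi (bstar F) x) y = inner x (rep_ext pi F y).
Proof.
rewrite rep_ext_coef /= inner_conj rep_ext_coef; congr (_^*)%R; congr (F _).
by apply/blinP => a /=; rewrite rep_star inner_conj conjCK.
Qed.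

(** This translates the condition in pure decomposability, taken at a vector functional, into the
    vanishing of one vector. *)
Lemma bmul_bstar_coef F x :
  bmul (bstar F) F (coef x x) = (nr (rep_ext pi F x) ^+ 2)%:C.
Proof.
by rewrite -rep_ext_coef rep_ext_bmul rep_ext_bstar inner_xx.
Qed.

End representations.

(** * Schur's lemma *)

Section linear_maps.
Context {R : realType} {V W : lmodType R[i]} (f : V -> W).
Hypothesis fl : linear f.

Lemma linear_sub x y : f (x - y) = f x - f y.
Proof. by rewrite addrC -scaleN1r fl scaleN1r addrC. Qed.

Lemma linear_zero : f 0 = 0.
Proof. by rewrite -[X in f X](subrr 0) linear_sub subrr. Qed.

End linear_maps.

(** * A square root of the square of a self-adjoint contraction *)

Section square_root.
Context {R : realType} {H : hilbertType R}.
Variable T : H -> H.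
Hypothesis Tl : linear T.
Hypothesis T_self : forall x y, inner (T x) y = inner x (T y).
Hypothesis T_le1 : forall x, nr (T x) <= nr x.

(** The square of the left side is [|x|^2 - 2 |T x|^2 + |T (T x)|^2], and the last term is at most
    [|T x|^2]. *)
Lemma nr_sub_sqr_le x : nr (x - T (T x)) <= nr x.
Proof.
rewrite -ler_sqr ?nnegrE ?normr_re_ge0// nr_sqrB -T_self Re_inner_xx.
have := T_le1 (T x); have := normr_re_ge0 (T (T x)); have := normr_re_ge0 (T x).
nra.
Qed.

(* The limit [Y] satisfies [2 Y = 1 - T^2 + Y^2], that is [(1 - Y)^2 = T^2]. *)
Fixpoint sqrt_iter n : H -> H := if n is n.+1 then
    fun x => (2^-1)%:C *: (x - T (T x) + sqrt_iter n (sqrt_iter n x))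
  else fun=> 0.

(** The scalar iteration with [1 - T^2] replaced by its norm bound 1; it majorizes both the iterates
    and their increments. *)
Fixpoint sqrt_bound n : R :=
  if n is n.+1 then 2^-1 * (1 + sqrt_bound n ^+ 2) else 0.

Lemma sqrt_bound_itv n : 0 <= sqrt_bound n <= 1.
Proof. by elim: n => [|n /andP[? ?]] /=; rewrite ?lexx ?ler01//; apply/andP; split; nra. Qed.

Lemma sqrt_iter_linear n : linear (sqrt_iter n).
Proof.
elim: n => [|n IH] c x y /=; first by rewrite scaler0 addr0.
rewrite !Tl !IH scalerA mulrC -scalerA -scalerDr; congr (_ *: _).
by rewrite opprD [X in X + _]addrACA -scalerBr addrACA -scalerDr.
Qed.

Lemma sqrt_iter_le n x : nr (sqrt_iter n x) <= sqrt_bound n * nr x.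
Proof.
elim: n x => [|n IH] x /=; first by rewrite normr_re0 mul0r.
have [y0 _] := andP (sqrt_bound_itv n).
rewrite nr_scale_real ?invr_ge0 ?ler0n// -mulrA ler_wpM2l ?invr_ge0 ?ler0n//.
apply: le_trans (ler_normr_reD _ _) _.
rewrite mulrDl mul1r lerD ?nr_sub_sqr_le// expr2 -mulrA.
by apply: le_trans (IH _) _; rewrite ler_wpM2l.
Qed.

Lemma sqrt_iter_step n x : nr (sqrt_iter n.+1 x - sqrt_iter n x)
  <= (sqrt_bound n.+1 - sqrt_bound n) * nr x.
Proof.
elim: n x => [|n IH] x.
  rewrite /= !subr0 expr0n addr0 addr0 mulr1 nr_scale_real ?invr_ge0 ?ler0n//.
  by rewrite ler_wpM2l ?invr_ge0 ?ler0n// nr_sub_sqr_le.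
have step m : sqrt_iter m.+1 = fun x =>
  (2^-1)%:C *: (x - T (T x) + sqrt_iter m (sqrt_iter m x)) by [].
rewrite [sqrt_iter n.+2]step; set Y' := sqrt_iter n.+1; set Y := sqrt_iter n.
have -> : Y' x = (2^-1)%:C *: (x - T (T x) + Y (Y x)) by [].
rewrite -scalerBr nr_scale_real ?invr_ge0 ?ler0n//.
have -> : (2^-1)%:C *: (x - T (T x) + Y (Y x)) = Y' x by [].
rewrite opprD addrACA subrr add0r.
(* Noncommutative difference of squares: the bounds for the two terms add up to [y'^2 - y^2], which
   is twice the next scalar increment. *)
have -> : Y' (Y' x) - Y (Y x) = Y' (Y' x - Y x) + (Y' (Y x) - Y (Y x)).
  by rewrite /Y' (linear_sub (@sqrt_iter_linear n.+1)) addrA subrK.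
have [y0 _] := andP (sqrt_bound_itv n); have [y1 _] := andP (sqrt_bound_itv n.+1).
have := ler_normr_reD (Y' (Y' x - Y x)) (Y' (Y x) - Y (Y x)).
have := le_trans (sqrt_iter_le n.+1 (Y' x - Y x)) (ler_wpM2l y1 (IH x)).
have d0 : 0 <= sqrt_bound n.+1 - sqrt_bound n.
  by have := sqr_ge0 (1 - sqrt_bound n); rewrite /=; nra.
have := le_trans (IH (Y x)) (ler_wpM2l d0 (sqrt_iter_le n x)).
have -> : sqrt_bound n.+2 = 2^-1 * (1 + sqrt_bound n.+1 ^+ 2) by [].
have : sqrt_bound n.+1 = 2^-1 * (1 + sqrt_bound n ^+ 2) by [].
rewrite -/Y' -/Y; move: (sqrt_bound n.+1) (sqrt_bound n) => y' y yE.
have -> : 2^-1 * (1 + y' ^+ 2) - y' = 2^-1 * ((y' - y) * (y' + y)) by lra.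
lra.
Qed.

(** [D] is [1 - Y]. The bound on [x - D x] stands in for positivity of [D], and the commutation
    clause holds because every iterate is a polynomial in [T]. *)
Lemma sqrt_sqr_exists : exists D : H -> H, [/\ linear D,
  forall x, nr (x - D x) <= nr x, forall x, D (D x) = T (T x) &
  forall f : H -> H, linear f -> (exists C, forall x, nr (f x) <= C * nr x) ->
    (forall x, f (T x) = T (f x)) -> forall x, f (D x) = D (f x)].
Proof.
have /choice[Y YP] x : exists l, nr_cvg (sqrt_iter ^~ x) l.
  apply: completeNormedMod_nr_complete.
  apply: (@nr_cauchy_majorant _ _ _ (fun n => sqrt_bound n * nr x) (nr x)) => n.
    by rewrite -mulrBl; exact: sqrt_iter_step.
  by have [_ y1] := andP (sqrt_bound_itv n); rewrite ler_piMl ?normr_re_ge0.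
have itle n x : nr (sqrt_iter n x) <= 1 * nr x.
  have [_ y1] := andP (sqrt_bound_itv n).
  by apply: le_trans (sqrt_iter_le _ _) _; rewrite ler_wpM2r ?normr_re_ge0.
have Yl : linear Y.
  move=> c x y; apply: nr_cvg_unique (YP _) _.
  rewrite (_ : sqrt_iter ^~ _ = fun n => c *: sqrt_iter n x + sqrt_iter n y).
    exact: nr_cvgD (nr_cvgZ c (YP x)) (YP y).
  by apply/funext => n; rewrite sqrt_iter_linear.
have Y_le x : nr (Y x) <= nr x.
  by apply: nr_cvg_le (YP x) _ => n; rewrite -[leRHS]mul1r.
(* Pointwise convergence with a moving argument: the iterates are uniformly contractive, so
   replacing [sqrt_iter n x] by its limit costs a vanishing error. *)
have YY x : nr_cvg (fun n => sqrt_iter n (sqrt_iter n x)) (Y (Y x)).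
  rewrite (_ : (fun n => _) = fun n =>
      sqrt_iter n (sqrt_iter n x - Y x) + sqrt_iter n (Y x)); last first.
    by apply/funext => n; rewrite (linear_sub (@sqrt_iter_linear n)) subrK.
  rewrite -[Y (Y x)]add0r; apply: nr_cvgD (YP _) => e /(YP x)[N YN].
  exists N => n /YN; apply: le_lt_trans; rewrite subr0.
  by rewrite -[leRHS]mul1r.
have Yeq x : Y x = (2^-1)%:C *: (x - T (T x) + Y (Y x)).
  apply: nr_cvg_unique (nr_cvg_shift (YP x)) _.
  exact: nr_cvgZ (nr_cvgD (nr_cvg_cst _) (YY x)).
exists (fun x => x - Y x); split=> [c x y|x|x|f fl [C fC] fT x].
- by rewrite Yl opprD addrACA -scalerBr.
- by rewrite subKr.
- rewrite (linear_sub Yl) opprB.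
  have : Y x + Y x = x - T (T x) + Y (Y x).
    rewrite {1 2}(Yeq x) -scalerDl -rmorphD /=.
    by rewrite (_ : 2^-1 + 2^-1 = 1) ?scale1r//; field.
  move=> YxE; apply/eqP; rewrite -subr_eq0; apply/eqP.
  transitivity (x - T (T x) + Y (Y x) - (Y x + Y x)); last by rewrite -YxE subrr.
  by rewrite opprD !addrA; do !rewrite [_ - T (T x)]addrAC -?[_ + Y (Y x) - _]addrAC.
- rewrite (linear_sub fl); congr (_ - _).
  have fY n : f (sqrt_iter n x) = sqrt_iter n (f x).
    have f0 := linear_zero fl.
    elim: n x => [|n IH] z //=.
    rewrite -[in LHS](addr0 (_ *: _)) fl f0 addr0; congr (_ *: _).
    by rewrite -[in LHS](scale1r (z - _)) fl scale1r (linear_sub fl) !IH !fT.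
  apply: nr_cvg_unique (YP (f x)).
  rewrite (_ : sqrt_iter ^~ _ = f \o (sqrt_iter ^~ x)); last first.
    by apply/funext => n; rewrite /= fY.
  by apply: nr_cvg_lip (YP x) => y z; rewrite -(linear_sub fl).
Qed.

End square_root.

(** * The self-adjoint commutant of an irreducible representation *)

Section schur.
Context {R : realType} {A : cstarAlgType R} {H : hilbertType R}.
Variable pi : representation A H.
Hypothesis irr : irreducible pi.

(** The kernel of a bounded operator in the commutant is a closed invariant subspace; one nonzero
    vector in it makes it everything. *)
Lemma irreducible_ker (g : H -> H) (C : R) x0 : linear g ->
  (forall x, nr (g x) <= C * nr x) -> (forall a x, g (pi a x) = pi a (g x)) ->
  x0 != 0 -> g x0 = 0 -> forall x, g x = 0.
Proof.
move=> gl gC gpi x00 gx0.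
have g0 := linear_zero gl.
have [|||K0|KT] := irr.2 [set x | g x = 0].
- by split=> // c x y /= gx gy; rewrite gl gx gy scaler0 addr0.
- by apply: (@closed_ker _ _ _ _ C) => x y; rewrite -(linear_sub gl).
- by move=> a x /= gx; rewrite gpi gx linear0.
- by have : [set x | g x = 0] x0 by []; rewrite K0 /= => /eqP; rewrite (negPf x00).
- by move=> x; have : [set: H] x by []; rewrite -KT.
Qed.

Lemma irreducible_nonzero : exists x : H, x != 0.
Proof.
have [[a [x pax]] _] := irr; exists x.
by apply: contraNneq pax => ->; rewrite linear0.
Qed.

(* Take [D] with [D^2 = T^2], commuting with everything that commutes with [T].
   Since [(D - T) (D + T) = 0], irreducibility forces [D = T] or [D = - T]; as
   [|1 - D| <= 1], the vanishing of [<D e, e>] gives [D e = 0]. *)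
Lemma schur_contraction (T : H -> H) (e : H) : linear T ->
  (forall x y, inner (T x) y = inner x (T y)) -> (forall x, nr (T x) <= nr x) ->
  (forall a x, T (pi a x) = pi a (T x)) ->
  e != 0 -> inner (T e) e = 0 -> forall x, T x = 0.
Proof.
move=> Tl T_self T_le1 Tpi e0 Tee.
have [D [Dl D1 DD Dcomm]] := sqrt_sqr_exists Tl T_self T_le1.
have Tb : exists C, forall x, nr (T x) <= C * nr x by exists 1 => x; rewrite mul1r.
have DT x : T (D x) = D (T x) by apply: Dcomm.
have Dpi a x : D (pi a x) = pi a (D x).
  rewrite (Dcomm (pi a))// => [c y z|]; first by rewrite linearP.
  by exists (nr (pi a)) => y; exact: blin_le.
have D2 x : nr (D x) <= 2 * nr x.
  have := nr_dist_trans x (D x) 0; rewrite !subr0 (nrBC (D x)).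
  by have := D1 x; lra.
suff Te : T e = 0.
  apply: (@irreducible_ker T 1 e) => // x; by rewrite mul1r.
(* If [D e] is orthogonal to [e], then [|e - D e|^2 = |e|^2 + |D e|^2], which must not exceed
   [|e|^2]. *)
have D_inner_eq0 : inner (D e) e = 0 -> D e = 0.
  move=> Dee; apply: normr_re_eq0.
  have := nr_sqrB e (D e); rewrite inner_conj Dee conjC0 /= mulr0 subr0.
  have := D1 e; rewrite -ler_sqr ?nnegrE ?normr_re_ge0// => h1 h2.
  by apply/eqP; rewrite -sqrf_eq0 eq_le sqr_ge0 andbT; lra.
have [DeqT|] := pselect (forall x, D x - T x = 0).
  have De : D e = T e by apply/eqP; rewrite -subr_eq0 DeqT.
  by rewrite -De; apply: D_inner_eq0; rewrite De.
move=> /existsNP[y /eqP y0].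
have DNT : forall x, D x + T x = 0.
  apply: (@irreducible_ker (fun x => D x + T x) 3 (D y - T y)) => //.
  - by move=> c u v; rewrite Dl Tl addrACA -scalerDr.
  - move=> x; apply: le_trans (ler_normr_reD _ _) _.
    by have := D2 x; have := T_le1 x; lra.
  - by move=> a x; rewrite Dpi Tpi linearD.
  - by rewrite (linear_sub Dl) (linear_sub Tl) DD DT addrC addrA subrK subrr.
have De : D e = - T e by apply/eqP; rewrite -addr_eq0 DNT.
by apply/eqP; rewrite -oppr_eq0 -De; apply/eqP/D_inner_eq0; rewrite De innerNl Tee oppr0.
Qed.

(** Subtracting the Rayleigh quotient [r] at [e] makes the quadratic form vanish at [e]; division by
    [K] then gives a contraction to which [schur_contraction] applies. *)
Lemma schur (S : H -> H) : linear S ->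
  (forall x y, inner (S x) y = inner x (S y)) ->
  (exists C, forall x, nr (S x) <= C * nr x) ->
  (forall a x, S (pi a x) = pi a (S x)) ->
  exists lam : R[i], forall x, S x = lam *: x.
Proof.
move=> Sl S_self [C SC] Spi; have [e e0] := irreducible_nonzero.
pose r := complex.Re (inner (S e) e) / nr e ^+ 2.
have e2 : nr e ^+ 2 != 0 by rewrite sqrf_eq0 gt_eqF// nr_gt0.
have See : inner (S e) e = r%:C * inner e e.
  have : inner (S e) e = ((inner (S e) e)^*)%R by rewrite -inner_conj -S_self.
  rewrite inner_xx /r => h; apply: complex_ext.
    by rewrite /= mul0r subr0 divfK.
  by move: h; case: (inner _ _) => a b /= [h]; rewrite mul0r mulr0 addr0; lra.
exists r%:C => x; apply/eqP; rewrite -subr_eq0; apply/eqP.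
pose K := `|C| + `|r| + 1.
have K0 : 0 < K by rewrite ltr_wpDl// addr_ge0.
pose T x := (K^-1)%:C *: (S x - r%:C *: x).
have KK : (K^-1)%:C != 0 :> R[i].
  by rewrite (_ : 0 = 0%:C)// (inj_eq (@complexI R)) invr_eq0 gt_eqF.
suff : T x = 0 by move=> /eqP; rewrite scaler_eq0 (negPf KK) => /eqP.
have T_inner u v : inner (T u) v = (K^-1)%:C * (inner (S u) v - r%:C * inner u v).
  by rewrite /T innerZl innerBl innerZl.
apply: (@schur_contraction T e) => //.
- move=> c u v; rewrite /T Sl scalerA [c * _]mulrC -scalerA -scalerDr; congr (_ *: _).
  by rewrite scalerDr opprD addrACA scalerA [r%:C * _]mulrC -scalerA -scalerBr.
- move=> u v; rewrite T_inner /T innerZr innerBr innerZr S_self.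
  by rewrite !conj_Creal ?complex_real.
- move=> u; rewrite /T nr_scale_real ?invr_ge0 ?(ltW K0)// mulrC ler_pdivrMr//.
  rewrite -{1}[_ - _]/(_ + _) (le_trans (ler_normr_reD _ _))// nrN normr_reZ nr_real.
  rewrite /K mulrDr mulrDr mulr1 -addrA lerD//; last by rewrite mulrC lerDl normr_re_ge0.
  by rewrite mulrC (le_trans (SC _))// ler_wpM2r ?normr_re_ge0// ler_norm.
- by move=> a u; rewrite /T Spi blin_appZ blin_appB blin_appZ.
- by rewrite T_inner See subrr mulr0.
Qed.

End schur.

(** * Purity of vector states *)

Section product_functionals.
Context {R : realType} {A : cstarAlgType R}.
Implicit Types a b h r v x : A.

(** [r] is the Neumann series [h + h^2 + ...], so that [1 + r] is a right inverse of [1 - h] in the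
    unitization. *)
Lemma quasi_inverse_exists h : nr h <= 2^-1 -> exists r, r = h + cmul h r.
Proof.
move=> h2; pose u := fix u n : A := if n is n.+1 then h + cmul h (u n) else 0.
have [r ur] : exists r, nr_cvg u r.
  apply: completeNormedMod_nr_complete.
  apply: (@nr_cauchy_majorant _ _ _ (fun n => 1 - 2^-1 ^+ n) 1) => n; last first.
    by rewrite gerBl exprn_ge0// invr_ge0.
  have -> : 1 - 2^-1 ^+ n.+1 - (1 - 2^-1 ^+ n) = 2^-1 ^+ n.+1 :> R.
    by rewrite exprS; move: (2^-1 ^+ n) => p; field.
  elim: n => [|n IH]; first by rewrite /= cmul0r addr0 subr0 expr1.
  have -> : u n.+2 - u n.+1 = cmul h (u n.+1 - u n).
    rewrite -[u n.+2]/(h + cmul h (u n.+1)) -[in LHS]/(h + cmul h (u n)).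
    by rewrite opprD addrACA subrr add0r -cmulNr -cmulDr.
  apply: le_trans (normr_re_cmul _ _) _; rewrite exprS.
  by rewrite ler_pM ?normr_re_ge0.
exists r; apply: nr_cvg_unique (nr_cvg_shift ur) _.
apply: nr_cvgD (nr_cvg_cst h) _; apply: (nr_cvg_lip (C := nr h) _ ur) => a b.
by rewrite -cmulNr -cmulDr normr_re_cmul.
Qed.

(* [1 + v] is unitary in the unitization exactly when the hypothesis holds;
   [w] is [(1 + v)^k - 1], whence its bound and its value modulo products. *)
Lemma unitary_power_exists v k : cmul (cstar v) v = - (v + cstar v) ->
  exists w, nr w <= 2 /\
    exists b, w = k%:R *: v + cmul v b.
Proof.
move=> vU; pose L x := x + cmul v x.
(* [L] is left multiplication by the isometry [1 + v] of the unitization. *)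
have L_isom x : nr (L x) = nr x.
  apply/eqP; rewrite -(@eqrXn2 _ 2)// ?normr_re_ge0// -!nr_cstar_cmul; apply/eqP.
  congr nr; rewrite /L cstarD cstarM cmulDl !cmulDr -!cmulA.
  rewrite [cmul (cstar v) (cmul v x)]cmulA vU.
  rewrite cmulNl cmulNr cmulDl cmulDr.
  by rewrite -[RHS]addr0 -!addrA; congr (_ + _); rewrite addrA subrr.
pose w := fix w n : A := if n is n.+1 then v + L (w n) else 0.
have LB x y : L (x - y) = L x - L y.
  by rewrite /L cmulDr cmulNr opprD addrACA.
have wL n x : cmul (w n) x = iter n L x - x.
  elim: n => [|n IH] /=; first by rewrite cmul0l subrr.
  rewrite cmulDl {1}/L cmulDl -cmulA -[cmul (w n) x + _]/(L (cmul (w n) x)) IH LB.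
  have -> : L x = cmul v x + x by rewrite /L addrC.
  by rewrite opprD addrCA (addrA (cmul v x)) subrr add0r.
have iter_isom n x : nr (iter n L x) = nr x by elim: n => //= n <-; rewrite L_isom.
exists (w k); split.
  (* [|w|^2] is the norm of the product of [w] and [cstar w], and by [wL] that product is a
     difference of two elements of norm [|w|]. *)
  have [->|w0] := eqVneq (nr (w k)) 0; first by rewrite ler0n.
  have wgt0 : 0 < nr (w k) by rewrite lt_def w0 normr_re_ge0.
  rewrite -(ler_pM2r wgt0) -{1 2 3}normr_re_cstar -expr2 -nr_cstar_cmul cstarK wL.
  apply: le_trans (ler_normr_reD _ _) _.
  by rewrite nrN iter_isom !normr_re_cstar mulr_natl.
elim: k => [|k [b wE]] /=; first by exists 0; rewrite scale0r cmul0r addr0.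
exists (w k + b); rewrite /L {1}wE -natr1 scalerDl scale1r cmulDr.
by rewrite [_ *: v + v]addrC -!addrA; congr (_ + (_ + _)); rewrite addrC.
Qed.

(* This replaces approximate units: for small self-adjoint [h] the Cayley
   transform of [i h] yields [v], equal to [2 i h] modulo products, with
   [1 + v] unitary, and then [k |f v| <= 2 |f|] for every [k]. *)
Lemma dual_eq0_of_products (f : dual A) :
  (forall a b, f (cmul a b) = 0) -> f = 0.
Proof.
move=> f0; have self h : cstar h = h -> f h = 0.
  move=> hh; pose s : R := (2 * (nr h + 1))^-1.
  have h1 : 0 < nr h + 1 by rewrite ltr_wpDl ?normr_re_ge0.
  have s0 : 0 < s by rewrite invr_gt0 mulr_gt0.
  pose k := 'i%C * s%:C; have kconj : (k^*)%R = - k.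
    by rewrite /k; apply: complex_ext; rewrite /=; ring.
  have k0 : k != 0.
    rewrite mulf_neq0//; first by rewrite eq_complex /= oner_eq0 andbF.
    by rewrite (_ : 0 = 0%:C)// (inj_eq (@complexI R)) gt_eqF.
  have kn : nr (k : R[i]^o) = s.
    rewrite /k nr_complexM nr_real (gtr0_norm s0).
    have -> : nr ('i%C : R[i]^o) = 1; last by rewrite mul1r.
    by apply/eqP; rewrite -(@eqrXn2 _ 2)// ?normr_re_ge0// nr_complex_sqr /= expr0n add0r.
  have [r rE] : exists r, r = k *: h + cmul (k *: h) r.
    apply: quasi_inverse_exists; rewrite normr_reZ kn /s mulrC.
    by rewrite ler_pdivrMr ?mulr_gt0//; lra.
  set g := k *: h in rE; have gs : cstar g = - g by rewrite cstarZ hh kconj scaleNr.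
  have rsE : cstar r + cmul (cstar r) g = - g.
    by rewrite {1}rE cstarD cstarM gs cmulNr -addrA addNr addr0.
  (* [1 + 2 r] is the Cayley transform [(1 + g) (1 - g)^-1] of the skew-adjoint [g]; this is half of
     its unitarity equation. *)
  have rU : cmul (cstar r) r + cmul (cstar r) r = - (r + cstar r).
    have rsg : cmul (cstar r) g = - g - cstar r by rewrite -rsE addrC addKr.
    have rNE : - r = - g - cmul g r by rewrite {1}rE opprD.
    have rrE : cmul (cstar r) r = - g - cstar r + cmul (- g - cstar r) r.
      by rewrite -rsg {2}rE cmulDr cmulA.
    by rewrite {1}rrE cmulDl !cmulNl addrA subrK opprD rNE addrAC.
  have vU : cmul (cstar (2 *: r)) (2 *: r) = - (2 *: r + cstar (2 *: r)).
    rewrite cstarZ conjC_nat cmulZl cmulZr -scalerDr -scalerN -rU; congr (_ *: _).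
    by rewrite -[2]/(1 + 1) scalerDl scale1r.
  have fv : f (2 *: r) = 0.
    apply: (@normr_re_eq0 _ (R[i]^o : normedModType R[i])).
    apply/eqP; rewrite eq_le normr_re_ge0 andbT leNgt; apply/negP => fgt0.
    pose n := (Num.truncn (nr f * 2 / nr (f (2 *: r)))).+1.
    have [w [w2 [b wE]]] := unitary_power_exists n vU.
    have := blin_le f w; rewrite wE blin_appD f0 addr0 blin_appZ normr_reZ.
    rewrite -wE -(rmorph_nat (real_complex R)) nr_real ger0_norm ?ler0n//.
    apply/negP; rewrite -ltNge.
    apply: (@le_lt_trans _ _ (nr f * 2)); first by rewrite ler_wpM2l ?normr_re_ge0.
    by rewrite -ltr_pdivrMr// truncnS_gt.
  have fr : f r = 0.
    by move: fv; rewrite blin_appZ => /eqP; rewrite scaler_eq0 pnatr_eq0 => /eqP.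
  move: fr; rewrite rE blin_appD f0 addr0 blin_appZ => /eqP.
  by rewrite scaler_eq0 (negPf k0) => /eqP.
apply/blinP => a; rewrite blin0E.
have h1 : f (a + cstar a) = 0 by apply: self; rewrite cstarD cstarK addrC.
have h2 : f ('i%C *: (a - cstar a)) = 0.
  apply: self; rewrite cstarZ cstarD cstarN cstarK.
  have -> : ('i%C^*)%R = - 'i%C :> R[i] by apply: complex_ext; rewrite /= ?oppr0.
  by rewrite scaleNr -scalerN opprB.
have h3 : f (a - cstar a) = 0.
  move: h2; rewrite blin_appZ => /eqP; rewrite scaler_eq0 eq_complex /= oner_eq0 andbF.
  by move/eqP.
have : f (2 *: a) = 0.
  have -> : 2 *: a = (a + cstar a) + (a - cstar a).
    by rewrite addrACA subrr addr0 -[2]/(1 + 1) scalerDl scale1r.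
  by rewrite blin_appD h1 h3 addr0.
by rewrite blin_appZ => /eqP; rewrite scaler_eq0 pnatr_eq0 => /eqP.
Qed.

End product_functionals.

(** * Vector functionals of irreducible representations *)

Section vector_states.
Context {R : realType} {A : cstarAlgType R} {H : hilbertType R}.
Variable pi : representation A H.
Hypothesis irr : irreducible pi.

(** The vectors annihilated by all of [pi] form a closed invariant subspace, which is not the whole
    space because [pi] is nonzero. *)
Lemma irreducible_nondegenerate (x : H) : x != 0 -> exists a, pi a x != 0.
Proof.
move=> x0; have [_ /(_ [set x | forall a, pi a x = 0])[|||L0|LT]] := irr.
- split=> [a|c y z y0 z0 a]; first exact: blin_app0.
  by rewrite blin_appD blin_appZ y0 z0 scaler0 addr0.
- apply: (@closed_common_ker _ A _ _ (fun a y => pi a y) (fun a => nr (pi a))) => a y z.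
  by rewrite -blin_appB blin_le.
- by move=> a y y0 b; rewrite y0 blin_app0.
- apply/not_existsP => h; have : [set x | forall a, pi a x = 0] x.
    by move=> a; have /negP := h a; rewrite negbK => /eqP.
  by rewrite L0 => /eqP; rewrite (negPf x0).
- have [[a [y /eqP pay]] _] := irr.
  by have : [set: H] y by []; rewrite -LT => /(_ a).
Qed.

(** Cyclicity of [x] in dual form. The orthogonal complement of its orbit is closed and invariant,
    and it is not everything, since the orbit contains a nonzero vector. *)
Lemma irreducible_cyclic (x y : H) :
  x != 0 -> (forall a, inner (pi a x) y = 0) -> y = 0.
Proof.
move=> x0 xy; have [_ /(_ [set y | forall a, inner y (pi a x) = 0])[|||L0|LT]] := irr.
- split=> [a|c u v u0 v0 a]; first exact: inner0l.
  by rewrite inner_linearl u0 v0 mulr0 addr0.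
- apply: (@closed_common_ker _ A _ (R[i]^o : normedModType R[i])
    (fun a y => inner y (pi a x)) (fun a => nr (pi a x))) => a u v.
  by rewrite -innerBl mulrC nr_inner_le.
- by move=> a u u0 b; rewrite rep_adjoint -rep_mul u0.
- have : [set y | forall a, inner y (pi a x) = 0] y.
    by move=> a; rewrite inner_conj xy conjC0.
  by rewrite L0.
- have [a /eqP pax] := irreducible_nondegenerate x0; case: pax.
  have : [set: H] (pi a x) by []; rewrite -LT => /(_ a).
  exact: inner_xx_eq0.
Qed.

Lemma irreducible_cyclic_ext (x y z : H) : x != 0 ->
  (forall a, inner (pi a x) y = inner (pi a x) z) -> y = z.
Proof.
move=> x0 yz; apply/eqP; rewrite -subr_eq0; apply/eqP.
by apply: (irreducible_cyclic x0) => a; rewrite innerBr yz subrr.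
Qed.

(* The Radon-Nikodym derivative of [g] with respect to the vector functional is
   a self-adjoint operator in the commutant, hence a scalar by Schur's lemma. *)
Lemma dominated_functional (x : H) (g : dual A) : x != 0 ->
  (forall a, 0 <= g (cmul (cstar a) a)) ->
  (forall a, complex.Re (g (cmul (cstar a) a)) <= nr (pi a x) ^+ 2) ->
  exists mu : R[i], g = mu *: coef pi x x.
Proof.
move=> x0 g0 g_le; pose B b a := g (cmul (cstar a) b) : R[i].
have Bl c u v w : B (c *: u + v) w = c * B u w + B v w.
  by rewrite /B cmul_linearr linearP.
have Br c u v w : B w (c *: u + v) = (c^*)%R * B w u + B w v.
  by rewrite /B cstar_semilinear cmul_linearl linearP.
have B_le b a : nr (B b a : R[i]^o) <= nr (pi a x) * nr (pi b x).
  rewrite -ler_sqr ?nnegrE ?mulr_ge0 ?normr_re_ge0// exprMn mulrC.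
  apply: le_trans (positive_form_cs Bl Br g0 b a) _.
  have Re_ge0 c : 0 <= complex.Re (B c c) by have := g0 c; rewrite lecE => /andP[].
  by apply: ler_pM => //; exact: g_le.
have Jl : linear (fun a => pi a x) by move=> c a b; rewrite linearP.
(* [z a] is the intended value of the derivative at [pi a x]. *)
have /choice[z zP] a : exists z, (forall b, B b a = inner (pi b x) z) /\
    nr z <= nr (pi a x).
  have [||||z] := @riesz _ H _ (fun b => pi b x) (B^~ a) (nr (pi a x)) => //.
  - by move=> c u v; exact: Bl.
  - exact: normr_re_ge0.
  - by exists z.
have zl : linear z.
  move=> c a b; apply: (irreducible_cyclic_ext x0) => d.
  by rewrite -(zP _).1 Br inner_linearr -!(zP _).1.
(* [S] is first obtained on all of [H] as the adjoint of the partial map [pi a x |-> z a]; [Sz]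
   shows that it extends this map. *)
have /choice[S SP] y : exists s, (forall a, inner (z a) y = inner (pi a x) s) /\
    nr s <= nr y.
  have [||||s] := @riesz _ H _ (fun b => pi b x) (fun a => inner (z a) y) (nr y) => //.
  - by move=> c u v; rewrite zl inner_linearl.
  - exact: normr_re_ge0.
  - move=> b; apply: le_trans (nr_inner_le _ _) _; rewrite mulrC.
    by rewrite ler_wpM2l ?normr_re_ge0// (zP b).2.
  - by exists s.
have Sl : linear S.
  move=> c u v; apply: (irreducible_cyclic_ext x0) => d.
  by rewrite -(SP _).1 !inner_linearr !(SP _).1.
have Sz a : S (pi a x) = z a.
  apply: (irreducible_cyclic_ext x0) => b; rewrite -(SP _).1 -(zP _).1.
  by rewrite inner_conj -(zP _).1 -positive_form_hermitian.
have Spi c y : S (pi c y) = pi c (S y).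
  apply: (irreducible_cyclic_ext x0) => a; rewrite -(SP _).1.
  rewrite -!(rep_star pi) -rep_mul -(SP _).1; congr inner.
  apply: (irreducible_cyclic_ext x0) => b.
  by rewrite -(rep_star pi) cstarK -rep_mul -!(zP _).1 /B cstarM cstarK cmulA.
have S_self u v : inner (S u) v = inner u (S v).
  (* [w] is the adjoint of [S] at [v]; it suffices to compare it with [S v] on the orbit of [x]. *)
  have [||||w wP _] := @riesz _ H _ idfun (fun u => inner (S u) v) (nr v) => //.
  - by move=> c a b; rewrite Sl inner_linearl.
  - exact: normr_re_ge0.
  - move=> b; apply: le_trans (nr_inner_le _ _) _; rewrite mulrC.
    by rewrite ler_wpM2l ?normr_re_ge0// (SP b).2.
  - rewrite wP; congr inner; apply: (irreducible_cyclic_ext x0) => a.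
    by rewrite -[LHS]/(inner (idfun (pi a x)) w) -wP Sz (SP _).1.
have [|lam SE] := schur irr Sl S_self _ Spi.
  by exists 1 => y; rewrite mul1r (SP y).2.
exists (lam^*)%R; apply/eqP; rewrite -subr_eq0; apply/eqP.
apply: dual_eq0_of_products => a b; rewrite blinDE blinNE blinZE /=.
have -> : g (cmul a b) = B b (cstar a) by rewrite /B cstarK.
rewrite (zP _).1 -Sz SE innerZr -(rep_star pi) cstarK -rep_mul.
exact: subrr.
Qed.

Lemma coef_neq0 (x : H) : x != 0 -> 0 < nr (coef pi x x).
Proof.
move=> /irreducible_nondegenerate[a pax]; rewrite nr_gt0.
apply/eqP => /(congr1 (fun f : dual A => f (cmul (cstar a) a))) /=.
by rewrite rep_mul rep_star => /inner_xx_eq0/eqP; rewrite (negPf pax).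
Qed.

Lemma coef_square (x : H) a :
  coef pi x x (cmul (cstar a) a) = (nr (pi a x) ^+ 2)%:C.
Proof. by rewrite /= rep_mul rep_star inner_xx. Qed.

(* The norm of [coef pi x x] is [|x|^2], but normalizing by the norm itself
   avoids having to prove it. *)
Lemma vector_state_pure (x : H) : x != 0 ->
  pure_state ((nr (coef pi x x))^-1%:C *: coef pi x x).
Proof.
move=> x0; have m0 := coef_neq0 x0.
set m := nr (coef pi x x) in m0 *; set f := _ *: _.
have fE a : f (cmul (cstar a) a) = (m^-1 * nr (pi a x) ^+ 2)%:C.
  by rewrite [RHS]rmorphM /f blinZE coef_square.
have fst : state f.
  split=> [a|]; first by rewrite fE ler0c mulr_ge0 ?invr_ge0 ?sqr_ge0// ltW.
  by rewrite /f nr_scale_real ?invr_ge0 ?(ltW m0)// mulVf// gt_eqF.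
(* A state with a positive multiple below [f] is some [nu *: f]. Equality of norms gives [nu]
   modulus 1, and positivity makes it 1. *)
have key (g : dual A) (s : R) : state g -> 0 < s ->
    (forall a, s * complex.Re (g (cmul (cstar a) a)) <= m^-1 * nr (pi a x) ^+ 2) ->
    g = f.
  move=> [g0 g1] s0 g_le.
  have gE a : g (cmul (cstar a) a) = (complex.Re (g (cmul (cstar a) a)))%:C.
    by have := g0 a; rewrite lecE => /andP[/eqP/=]; case: (g _) => u v /= ->.
  have [||mu muE] := @dominated_functional x ((m * s)%:C *: g) x0.
  - move=> a; rewrite blinZE gE -[_ *: _]/(_ * _) -rmorphM ler0c.
    rewrite mulr_ge0// ?mulr_ge0 ?(ltW m0) ?(ltW s0)//.
    by have := g0 a; rewrite lecE => /andP[].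
  - move=> a; rewrite blinZE -[_ *: _]/(_ * _) ReZ -mulrA mulrC -ler_pdivlMr//.
    by rewrite [leRHS]mulrC.
  have gnu : exists nu : R[i], g = nu *: f.
    have ms : (m * s)%:C != 0 :> R[i].
      by rewrite (_ : 0 = 0%:C)// (inj_eq (@complexI R)) mulf_neq0 ?gt_eqF.
    exists (((m * s)%:C)^-1 * mu * m%:C); rewrite /f scalerA -!mulrA -rmorphM.
    by rewrite mulfV ?gt_eqF// mulr1 -scalerA -muE scalerA mulVf// scale1r.
  have [nu nuE] := gnu; have [a pax] := irreducible_nondegenerate x0.
  have nu1 : nr (nu : R[i]^o) = 1.
    by have := g1; rewrite nuE normr_reZ fst.2 mulr1.
  have q0 : 0 < m^-1 * nr (pi a x) ^+ 2.
    by rewrite mulr_gt0 ?invr_gt0 ?exprn_gt0// nr_gt0.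
  have : 0 <= nu.
    have := g0 a; rewrite nuE blinZE fE -[_ *: _]/(_ * _).
    by rewrite pmulr_lge0// ltcR.
  move=> nu0; rewrite nuE -[nu]ger0_norm//.
  by rewrite -[`|nu|](@normr_reE _ R[i]^o) nu1 scale1r.
split=> // f1 f2 t sf1 sf2 /andP[t0 t1] ff.
have fRe a : m^-1 * nr (pi a x) ^+ 2 =
    t * complex.Re (f1 (cmul (cstar a) a)) + (1 - t) * complex.Re (f2 (cmul (cstar a) a)).
  have /(congr1 (@complex.Re R)) := fE a.
  rewrite {1}ff blinDE !blinZE -![_ *: _]/(_ * _) ReD !ReZ => ->.
  by [].
have Re_ge0 g a : state g -> 0 <= complex.Re (g (cmul (cstar a) a)).
  by move=> [/(_ a)]; rewrite lecE => /andP[].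
have t1' : 0 < 1 - t by rewrite subr_gt0.
split.
- by apply: (key f1 t) => // a; rewrite fRe lerDl mulr_ge0 ?Re_ge0 ?(ltW t1').
- by apply: (key f2 (1 - t)) => // a; rewrite fRe lerDr mulr_ge0 ?Re_ge0 ?(ltW t0).
Qed.

Lemma purely_decomposable_ker (X : set (bidual A)) (T : bidual A -> bidual A) F x :
  purely_decomposable X T -> X F -> rep_ext pi F x = 0 -> rep_ext pi (T F) x = 0.
Proof.
move=> pd XF Fx; have [->|x0] := eqVneq x 0; first exact: blin_app0.
have := pd _ F (vector_state_pure x0) XF; set m := nr _.
have m0 : m^-1%:C != 0 :> R[i].
  by rewrite (_ : 0 = 0%:C)// (inj_eq (@complexI R)) invr_eq0 gt_eqF// coef_neq0.
rewrite !blin_appZ !bmul_bstar_coef Fx normr_re0 expr0n scaler0 => /(_ erefl)/eqP.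
rewrite scaler_eq0 (negPf m0) /= (_ : 0 = 0%:C)// (inj_eq (@complexI R)) sqrf_eq0.
by move=> /eqP/normr_re_eq0.
Qed.

End vector_states.

(** * The implementing transformation *)

Section subspaces.
Context {R : realType} {V : lmodType R[i]}.
Implicit Types X : set V.

Lemma subspaceB X x y : linear_subspace X -> X x -> X y -> X (x - y).
Proof. by move=> [_ XP] Xx Xy; rewrite addrC -scaleN1r; exact: XP. Qed.

Lemma subspaceD X x y : linear_subspace X -> X x -> X y -> X (x + y).
Proof. by move=> [_ XP] Xx Xy; rewrite -[x]scale1r; exact: XP. Qed.

Lemma subspaceZ X (c : R[i]) x : linear_subspace X -> X x -> X (c *: x).
Proof. by move=> [X0 XP] Xx; rewrite -[_ *: _]addr0; exact: XP. Qed.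

Lemma subspace_sum X (I : eqType) (s : seq I) (c : I -> R[i]) (v : I -> V) :
  linear_subspace X -> (forall i, i \in s -> X (v i)) ->
  X (\sum_(i <- s) c i *: v i).
Proof.
move=> XP; elim: s => [|i s IH] Xv; first by rewrite big_nil; exact: XP.1.
rewrite big_cons; apply: (XP.2) (Xv _ (mem_head _ _)) (IH _) => j js.
by apply: Xv; rewrite inE js orbT.
Qed.

Lemma subspace_range (W : lmodType R[i]) (f : W -> V) :
  linear f -> linear_subspace (range f).
Proof.
move=> fl; split; first by exists 0 => //; exact: linear_zero.
by move=> c _ _ [x _ <-] [y _ <-]; exists (c *: x + y); rewrite ?fl.
Qed.

Lemma spanned_mem n (v : 'I_n -> V) i : spanned v (v i).
Proof.
exists (fun j => (j == i)%:R) => //.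
rewrite (bigD1 i)//= eqxx scale1r big1 ?addr0// => j /negPf->.
by rewrite scale0r.
Qed.

Lemma spanned_sub n (v : 'I_n -> V) X :
  linear_subspace X -> (forall i, X (v i)) -> spanned v `<=` X.
Proof. by move=> XP Xv _ [c _ <-]; apply: subspace_sum. Qed.

Section linear_on.
Context {W : lmodType R[i]} (X : set V) (f : V -> W).
Hypotheses (XP : linear_subspace X) (fl : linear_on X f).

Lemma linear_on0 : f 0 = 0.
Proof.
have /esym := fl 1 XP.1 XP.1; rewrite !scale1r addr0 => f0.
by apply: (addrI (f 0)); rewrite f0 addr0.
Qed.

Lemma linear_onZ (c : R[i]) x : X x -> f (c *: x) = c *: f x.
Proof. by move=> Xx; rewrite -[c *: x]addr0 fl ?linear_on0 ?addr0//; exact: XP.1. Qed.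

Lemma linear_onD x y : X x -> X y -> f (x + y) = f x + f y.
Proof. by move=> Xx Xy; rewrite -[x in LHS]scale1r fl// scale1r. Qed.

Lemma linear_onB x y : X x -> X y -> f (x - y) = f x - f y.
Proof. by move=> Xx Xy; rewrite addrC -scaleN1r fl// scaleN1r addrC. Qed.

Lemma linear_on_sum (I : eqType) (s : seq I) (c : I -> R[i]) (v : I -> V) :
  (forall i, i \in s -> X (v i)) ->
  f (\sum_(i <- s) c i *: v i) = \sum_(i <- s) c i *: f (v i).
Proof.
elim: s => [|i s IH] Xv; first by rewrite !big_nil linear_on0.
have Xs j : j \in s -> X (v j) by move=> js; apply: Xv; rewrite inE js orbT.
rewrite !big_cons fl ?IH//; first by apply: Xv; exact: mem_head.
exact: subspace_sum.
Qed.

End linear_on.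

End subspaces.

(** * Orthonormal lists and Gram-Schmidt *)

Section orthonormal.
Context {R : realType} {H : hilbertType R}.
Implicit Types (s : seq H) (x y z : H).

Fixpoint orthonormal s := if s is x :: s' then
  [/\ nr x = 1, forall y, y \in s' -> inner y x = 0 & orthonormal s'] else True.

(** For orthonormal [s], the projection onto the orthogonal complement of the span of [s]. *)
Definition residual s x := x - \sum_(y <- s) inner x y *: y.

Lemma inner_sum_eq0 s (c : H -> R[i]) z :
  (forall y, y \in s -> inner y z = 0) -> inner (\sum_(y <- s) c y *: y) z = 0.
Proof.
elim: s => [|y s IH] sz; first by rewrite big_nil inner0l.
rewrite big_cons inner_linearl sz ?mem_head// mulr0 add0r.
by apply: IH => w ws; apply: sz; rewrite inE ws orbT.
Qed.

Lemma residual_orthogonal s x z : orthonormal s -> z \in s ->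
  inner (residual s x) z = 0.
Proof.
rewrite /residual; elim: s => [//|a s IH] /= [a1 ao so].
have aE : x - \sum_(y <- a :: s) inner x y *: y
    = residual s x - inner x a *: a by rewrite big_cons opprD addrCA addrC.
rewrite aE inE => /predU1P[->|zs]; rewrite innerBl innerZl; last first.
  by rewrite IH// (inner_conj z a) (ao z)// conjC0 mulr0 subr0.
rewrite inner_xx a1 expr1n mulr1 /residual innerBl.
by rewrite inner_sum_eq0// subr0 subrr.
Qed.

Lemma residual_sub s x (X : set H) : linear_subspace X -> X x ->
  (forall y, y \in s -> X y) -> X (residual s x).
Proof. by move=> XP Xx Xs; apply: subspaceB => //; exact: subspace_sum. Qed.

Lemma residual_linear s : linear (residual s).
Proof.
move=> c x y; rewrite /residual scalerBr scaler_sumr addrACA -opprD -big_split /=.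
by congr (_ - _); apply: eq_bigr => z _; rewrite inner_linearl scalerDl scalerA.
Qed.

Lemma orthonormal_cons s x : orthonormal s -> residual s x != 0 ->
  orthonormal ((nr (residual s x))^-1%:C *: residual s x :: s).
Proof.
move=> so r0; have nr0 : 0 < nr (residual s x) by rewrite nr_gt0.
split=> // [|y ys]; last first.
  by rewrite innerZr inner_conj residual_orthogonal// conjC0 mulr0.
by rewrite nr_scale_real ?invr_ge0 ?ltW// mulVf// gt_eqF.
Qed.

(** Gram-Schmidt, skipping each vector whose residual is already zero. A zero residual is the
    expansion of [x] in the basis [s]. *)
Lemma orthonormal_basis_exists n (v : 'I_n -> H) (X : set H) :
  linear_subspace X -> (forall i, X (v i)) ->
  exists s, [/\ orthonormal s, forall y, y \in s -> X y &
    forall x, spanned v x -> residual s x = 0].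
Proof.
move=> XP Xv; suff [s [so Xs vs]] : exists s, [/\ orthonormal s,
    forall y, y \in s -> X y & forall i, i \in index_enum 'I_n -> residual s (v i) = 0].
  exists s; split=> // _ [c _ <-].
  rewrite (linear_on_sum (X := setT))//; last by move=> ? ? ? _ _; exact: residual_linear.
  by rewrite big1// => i _; rewrite vs ?mem_index_enum// scaler0.
elim: (index_enum 'I_n) => [|i l [s [so Xs vs]]]; first by exists [::].
have [ri|ri] := eqVneq (residual s (v i)) 0.
  by exists s; split=> // j; rewrite inE => /predU1P[->//|/vs].
have so' := orthonormal_cons (x := v i) so ri.
set e := _ *: residual s (v i) in so'.
have resE x : residual (e :: s) x = residual s x - inner x e *: e.
  by rewrite /residual big_cons opprD addrCA addrC.
have nr0 : nr (residual s (v i)) != 0 by rewrite gt_eqF// nr_gt0.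
exists (e :: s); split=> // [y|j].
  rewrite inE => /predU1P[->|/Xs//]; apply: subspaceZ => //.
  exact: residual_sub.
rewrite inE => /predU1P[->|/vs rj]; last first.
  rewrite resE rj sub0r; apply/eqP; rewrite oppr_eq0; apply/eqP.
  have -> : inner (v j) e = 0; last by rewrite scale0r.
  by move/eqP: rj; rewrite subr_eq0 => /eqP->; apply: inner_sum_eq0; case: so'.
rewrite resE; apply/eqP; rewrite subr_eq0; apply/eqP.
have -> : inner (v i) e = (nr (residual s (v i)))%:C.
  have {1}-> : v i = residual s (v i) + \sum_(y <- s) inner (v i) y *: y.
    by rewrite subrK.
  rewrite innerDl inner_sum_eq0; last by case: so'.
  rewrite addr0 innerZr inner_xx conj_Creal ?complex_real// -rmorphM /=.
  by rewrite expr2 mulKf.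
by rewrite scalerA -rmorphM /= divff// scale1r.
Qed.

End orthonormal.

(** * The norm of a map defined on a subspace *)

Section operator_norm_on.
Context {R : realType} {V W : normedModType R[i]} (X : set V) (f : V -> W).
Hypotheses (hX : linear_subspace X) (fl : linear_on X f) (fb : bounded_on X f).

Lemma has_ubound_opnorm_on :
  has_ubound [set nr (f x) | x in [set x | X x /\ nr x <= 1]].
Proof.
have [M fM] := fb; exists `|M| => _ [x [Xx x1] <-]; apply: le_trans (fM _ Xx) _.
rewrite (@le_trans _ _ (`|M| * nr x)) ?ler_wpM2r ?normr_re_ge0 ?ler_norm//.
by rewrite ler_piMr.
Qed.

Lemma opnorm_on_ge0 : 0 <= opnorm_on X f.
Proof.
apply: (le_trans (normr_re_ge0 (f 0))).
apply: ub_le_sup; first exact: has_ubound_opnorm_on.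
by exists 0 => //; split; [exact: hX.1|rewrite normr_re0].
Qed.

Lemma opnorm_on_le x : X x -> nr (f x) <= opnorm_on X f * nr x.
Proof.
move=> Xx; have f0 := linear_on0 hX fl.
have [->|x0] := eqVneq x 0; first by rewrite f0 !normr_re0 mulr0.
have nx : 0 < nr x by rewrite nr_gt0.
rewrite -ler_pdivrMr// mulrC -nr_scale_real ?invr_ge0 ?(ltW nx)//.
rewrite -(linear_onZ hX fl)//; apply: ub_le_sup; first exact: has_ubound_opnorm_on.
exists ((nr x)^-1%:C *: x) => //; split; first exact: subspaceZ.
by rewrite nr_scale_real ?invr_ge0 ?(ltW nx)// mulVf ?gt_eqF.
Qed.

Lemma opnorm_on_le_bound (M : R) : 0 <= M ->
  (forall x, X x -> nr (f x) <= M * nr x) -> opnorm_on X f <= M.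
Proof.
move=> M0 fM; apply: ge_sup.
  by exists (nr (f 0)), 0 => //; split; [exact: hX.1|rewrite normr_re0].
move=> _ [x [Xx x1] <-]; apply: le_trans (fM _ Xx) _.
by rewrite ler_piMr.
Qed.

End operator_norm_on.

(** * Construction and boundedness of [t] for one irreducible representation *)

Section implementation.
Context {R : realType} {A : cstarAlgType R}.
Variables (p1 p2 : bidual A) (X : set (bidual A)) (k : constants A)
  (T : bidual A -> bidual A).
Hypotheses (hp1 : projection p1) (hp2 : projection p2) (hX : linear_subspace X)
  (hXp : X `<=` corner p1 p2) (hK : condition_K p1 p2 X k)
  (hT : linear_on X T) (hTpd : purely_decomposable X T).
Context {H : hilbertType R} (pi : representation A H).
Hypothesis irr : irreducible pi.

Local Notation Pi := (rep_ext pi).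
Local Notation range1 := (range (Pi p1)).
Local Notation range2 := (range (Pi p2)).

Lemma rep_ext_rangeP p x : projection p -> range (Pi p) x <-> Pi p x = x.
Proof.
by move=> [_ pp]; split=> [[y _ <-]|px]; [rewrite -rep_ext_bmul pp|exists x].
Qed.

Lemma rep_ext_range_subspace p : linear_subspace (range (Pi p)).
Proof. by apply: subspace_range => c x y; rewrite linearP. Qed.

Lemma corner_rep_ext F x : X F -> Pi p1 (Pi F x) = Pi F x /\ Pi F (Pi p2 x) = Pi F x.
Proof.
move=> /hXp[G _ <-]; rewrite !rep_ext_bmul -!(rep_ext_bmul pi p1 p1).
by rewrite -(rep_ext_bmul pi p2 p2) hp1.2 hp2.2.
Qed.

Lemma rep_extP c F G x : Pi (c *: F + G) x = c *: Pi F x + Pi G x.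
Proof. by rewrite rep_ext_linear. Qed.

Lemma rep_extZ c F x : Pi (c *: F) x = c *: Pi F x.
Proof. by rewrite -[c *: F]addr0 rep_extP rep_ext0 blin0E addr0. Qed.

Lemma rep_extD F G x : Pi (F + G) x = Pi F x + Pi G x.
Proof. by rewrite -[F]scale1r rep_extP !scale1r. Qed.

Lemma rep_ext_T_eq F G x : X F -> X G -> Pi F x = Pi G x ->
  Pi (T F) x = Pi (T G) x.
Proof.
move=> XF XG FG; apply/eqP; rewrite -subr_eq0; apply/eqP.
rewrite -rep_extB -(linear_onB hT)//.
apply: (purely_decomposable_ker irr hTpd); first exact: subspaceB.
by rewrite rep_extB FG subrr.
Qed.

Lemma rep_ext_T_eq0 : Pi p1 = 0 \/ Pi p2 = 0 -> forall F, X F -> Pi (T F) = 0.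
Proof.
move=> p0 F XF; apply/blinP => x; rewrite blin0E.
apply: (purely_decomposable_ker irr hTpd XF).
have [h1 h2] := corner_rep_ext x XF.
by case: p0 => p0; [rewrite -h1 p0|rewrite -h2 p0 blin0E blin_app0].
Qed.

Fact rank_one_subproof (u y : H) :
  linear (fun x : H => inner x u *: y) /\
  bounded_on [set: H] (fun x : H => inner x u *: y).
Proof.
split=> [c a b|]; first by rewrite inner_linearl scalerDl scalerA.
exists (nr u * nr y) => x _; rewrite normr_reZ mulrAC ler_wpM2r ?normr_re_ge0//.
by rewrite mulrC nr_inner_le.
Qed.

Definition rank_one (u y : H) : 'B(H, H) := blin_of (rank_one_subproof u y).

Lemma rank_one_le u y : nr (rank_one u y) <= nr u * nr y.
Proof.
apply: nr_blin_le_pt => [|x]; first by rewrite mulr_ge0 ?normr_re_ge0.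
rewrite /= normr_reZ mulrAC ler_wpM2r ?normr_re_ge0//.
by rewrite mulrC nr_inner_le.
Qed.

Section nonzero.
Hypotheses (p1_neq0 : Pi p1 != 0) (p2_neq0 : Pi p2 != 0).

Lemma constant_gt0 (V : set H) : finite_dim V -> V `<=` range2 ->
  V <> [set 0] -> 0 < k pi V.
Proof. by move=> Vf Vp V0; have [] := hK irr p1_neq0 p2_neq0 Vf Vp V0. Qed.

(** Condition K is only ever applied to rank one operators; [y] in the range of [pi p1] puts them
    into the required right ideal. *)
Lemma interpolation (V : set H) (u y : H) : finite_dim V -> V `<=` range2 ->
  V <> [set 0] -> range1 y -> exists F, [/\ X F,
    nr F <= k pi V * (nr u * nr y) & forall x, V x -> Pi F x = inner x u *: y].
Proof.
move=> Vf Vp V0 /(rep_ext_rangeP _ hp1) py.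
have [k0 /(_ (rank_one u y))] := hK irr p1_neq0 p2_neq0 Vf Vp V0.
case=> [|F [XF Fk FV]].
  by exists (rank_one u y) => x /=; rewrite blin_appZ py.
exists F; split=> //; apply: le_trans Fk _.
by rewrite ler_wpM2l ?(ltW k0) ?rank_one_le.
Qed.

Lemma spanned_neq0 n (v : 'I_n -> H) i : v i != 0 -> spanned v <> [set 0].
Proof. by move=> vi v0; have := spanned_mem v i; rewrite v0 => /eqP; rewrite (negPf vi). Qed.

(** This makes [t] well defined. For independent [v] and [w], some [E] in [X] takes the common value
    at both; it kills [v - w], hence so does [T E], and [E] links [F] at [v] to [G] at [w]. For
    proportional vectors, rescaling [G] is enough. *)
Lemma rep_ext_T_transport F G v w : X F -> X G -> range2 v -> range2 w ->
  v != 0 -> w != 0 -> Pi F v = Pi G w -> Pi (T F) v = Pi (T G) w.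
Proof.
move=> XF XG v2 w2 v0 w0 FG.
pose c := inner v w / inner w w; pose u := v - c *: w.
have ww : inner w w != 0 by apply: contra_neq w0; exact: inner_xx_eq0.
have uw : inner w u = 0.
  by rewrite inner_conj /u innerBl innerZl divfK// subrr conjC0.
have [u0|u0] := eqVneq u 0.
  have vE : v = c *: w by apply/eqP; rewrite -subr_eq0 -/u u0.
  have c0 : c != 0 by apply: contra_neq v0 => c0; rewrite vE c0 scale0r.
  have -> : Pi (T G) w = c *: Pi (T (c^-1 *: G)) w.
    by rewrite (linear_onZ hX hT)// rep_extZ scalerA mulfV// scale1r.
  rewrite [in LHS]vE blin_appZ; congr (_ *: _).
  apply: rep_ext_T_eq => //; first exact: subspaceZ.
  by rewrite rep_extZ -FG vE blin_appZ scalerA mulVf// scale1r.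
have uu : inner u u != 0 by apply: contra_neq u0; exact: inner_xx_eq0.
have vq : inner v u = inner u u.
  by rewrite -{1}[v](subrK (c *: w)) innerDl innerZl uw mulr0 addr0.
(* [v] and [w] have the same inner product with [q], so an element of [X] that
   interpolates a rank one operator [inner _ q *: y] takes the value [y] at
   both. *)
pose q := (((1 - c) / inner u u)^*)%R *: u + ((inner w w)^-1^*)%R *: w.
have wq1 : inner w q = 1.
  by rewrite /q innerDr !innerZr uw mulr0 add0r conjCK mulVf.
have vq1 : inner v q = 1.
  by rewrite /q innerDr !innerZr !conjCK vq divfK// mulrC subrK.
pose e (i : 'I_2) := if i == 0 then v else w.
have [||||E [XE _ EV]] := @interpolation (spanned e) q (Pi F v).
- by exists 2%N, e.
- apply: spanned_sub; first exact: rep_ext_range_subspace.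
  by move=> i; rewrite /e; case: ifP.
- exact: (@spanned_neq0 _ e 0).
- by apply/(rep_ext_rangeP _ hp1); rewrite (corner_rep_ext _ XF).1.
have Ev : Pi E v = Pi F v.
  by rewrite EV ?vq1 ?scale1r//; exact: (spanned_mem e 0).
have Ew : Pi E w = Pi F v.
  by rewrite EV ?wq1 ?scale1r//; exact: (spanned_mem e 1).
rewrite -(rep_ext_T_eq XE XF Ev) -(rep_ext_T_eq XE XG (etrans Ew FG)).
apply/eqP; rewrite -subr_eq0 -blin_appB; apply/eqP.
by apply: (purely_decomposable_ker irr hTpd XE); rewrite blin_appB Ev Ew subrr.
Qed.

Lemma range_neq0 p : Pi p != 0 -> exists2 v, range (Pi p) v & v != 0.
Proof.
move=> p0; apply: contrapT => h; case/eqP: p0; apply/blinP => x.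
rewrite blin0E; apply/eqP; rewrite -[_ == _]negbK; apply/negP => px.
by apply: h; exists (Pi p x) => //; exists x.
Qed.

Lemma spanned1E (v : H) : spanned (fun _ : 'I_1 => v) = [set c *: v | c in [set: R[i]]].
Proof.
apply/seteqP; split=> _ [c _ <-]; first by exists (c 0); rewrite ?big_ord1.
by exists (fun=> c); rewrite ?big_ord1.
Qed.

(** [u] is [v / |v|^2], the shortest vector with [inner v u = 1], so the constant of the line enters
    (b) without any loss. *)
Lemma interpolation1 (v y : H) (V := [set c *: v | c in [set: R[i]]]) :
  range2 v -> v != 0 -> range1 y ->
  exists F, [/\ X F, nr F * nr v <= k pi V * nr y & Pi F v = y].
Proof.
move=> v2 v0 y1; pose u := (nr v ^- 2)%:C *: v.
have nv : 0 < nr v by rewrite nr_gt0.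
have vu : inner v u = 1.
  rewrite innerZr conj_Creal ?complex_real// inner_xx -rmorphM /=.
  by rewrite mulVf// sqrf_eq0 gt_eqF.
have un : nr u = (nr v)^-1.
  rewrite nr_scale_real ?invr_ge0 ?sqr_ge0// expr2 invfM -mulrA mulVf ?mulr1//.
  by rewrite gt_eqF.
have [||||F [XF Fk FV]] := @interpolation V u y.
- by rewrite /V -spanned1E; exists 1%N, (fun=> v).
- by move=> _ [c _ <-]; apply: subspaceZ => //; exact: rep_ext_range_subspace.
- by rewrite /V -spanned1E; exact: (@spanned_neq0 _ (fun=> v) 0).
- by [].
exists F; split=> //; last first.
  by rewrite FV ?vu ?scale1r//; exists 1; rewrite ?scale1r.
by rewrite -ler_pdivlMr// (le_trans Fk)// un mulrCA mulrC.
Qed.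

Lemma implementing_map_exists : exists t : H -> H, implements p1 X T pi t.
Proof.
have [v v2 v0] := range_neq0 p2_neq0.
(* One base vector [v] serves for all [y], and [t y] will be [Pi (T (F y)) v]. Outside the range of
   [pi p1] the default [0] keeps [F y] in [X]. *)
have /choice[F FP] y : exists F, X F /\ (range1 y -> Pi F v = y).
  have [y1|y1] := pselect (range1 y); last by exists 0; split=> //; exact: hX.1.
  by have [F [XF _ FV]] := interpolation1 v2 v0 y1; exists F.
have XF y : X (F y) by have [] := FP y.
have Fv y : range1 y -> Pi (F y) v = y by have [] := FP y.
have tl : linear_on range1 (fun y => Pi (T (F y)) v).
  move=> c x y x1 y1; rewrite -rep_extP -(hT c)//.
  apply: rep_ext_T_eq => //; first exact: (hX.2).
  by rewrite rep_extP !Fv//; exact: (rep_ext_range_subspace p1).2.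
exists (fun y => Pi (T (F y)) v); split=> // G XG x.
have [G1 G2] := corner_rep_ext x XG.
have yr : range1 (Pi G x) by exists (Pi G x).
(* [x] need not lie in the range of [pi p2], but [G] vanishes at [x - pi p2 x], hence so does
   [T G]. *)
have -> : Pi (T G) x = Pi (T G) (Pi p2 x).
  apply/eqP; rewrite -subr_eq0 -blin_appB; apply/eqP.
  by apply: (purely_decomposable_ker irr hTpd XG); rewrite blin_appB G2 subrr.
have [x0|x0] := eqVneq (Pi p2 x) 0.
  rewrite x0 blin_app0 -G2 x0 blin_app0.
  by rewrite (linear_on0 (rep_ext_range_subspace p1) tl).
by apply: rep_ext_T_transport => //; rewrite ?G2 ?Fv.
Qed.

Section implementing_map.
Variable t : H -> H.
Hypothesis ht : implements p1 X T pi t.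

Let t_linear : linear_on range1 t := ht.1.
Let range1_subspace : linear_subspace range1 := rep_ext_range_subspace p1.

Lemma implementing_map_le (V : set H) y : bounded_on X T -> one_dim V ->
  V `<=` range2 -> range1 y -> nr (t y) <= k pi V * opnorm_on X T * nr y.
Proof.
move=> Tb [v v0 VE] Vr y1; have nv : 0 < nr v by rewrite nr_gt0.
have v2 : range2 v by apply: Vr; rewrite VE; exists 1; rewrite ?scale1r.
have [F [XF Fk Fv]] := interpolation1 v2 v0 y1.
have S0 := opnorm_on_ge0 hX Tb.
rewrite -Fv -ht.2//; apply: le_trans (rep_ext_le _ _ _) _.
apply: le_trans (ler_wpM2r (normr_re_ge0 v) (opnorm_on_le hX hT Tb XF)) _.
rewrite Fv -[leLHS]mulrA [leLHS]mulrC [leRHS]mulrAC ler_wpM2r//.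
by rewrite VE.
Qed.

Lemma implementing_map_bounded : bounded_on X T ->
  bounded_on range1 t /\
  opnorm_on range1 t <= constant_inf p2 k pi * opnorm_on X T.
Proof.
move=> Tb; have [v v2 v0] := range_neq0 p2_neq0.
have S0 := opnorm_on_ge0 hX Tb.
pose V := [set c *: v | c in [set: R[i]]].
have V1 : one_dim V by exists v.
have Vr : V `<=` range2.
  by move=> _ [c _ <-]; apply: subspaceZ => //; exact: rep_ext_range_subspace.
have k_gt0 W : one_dim W -> W `<=` range2 -> 0 < k pi W.
  move=> [w w0 ->] Wr; rewrite -spanned1E in Wr *.
  apply: constant_gt0 => //; first by exists 1%N, (fun=> w).
  exact: (@spanned_neq0 _ (fun=> w) 0).
have le W : one_dim W -> W `<=` range2 ->
    opnorm_on range1 t <= k pi W * opnorm_on X T.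
  move=> W1 Wr; apply: opnorm_on_le_bound => // [|y yr].
    by rewrite mulr_ge0// ltW// k_gt0.
  exact: implementing_map_le.
split; first by exists (k pi V * opnorm_on X T) => y; exact: implementing_map_le.
(* Passing to the infimum over lines requires division by the norm of [T]. *)
have [S_eq0|S_neq0] := eqVneq (opnorm_on X T) 0.
  by have := le V V1 Vr; rewrite S_eq0 !mulr0.
have S_gt0 : 0 < opnorm_on X T by rewrite lt_def S_neq0.
rewrite -ler_pdivrMr//; apply: lb_le_inf; first by exists (k pi V), V.
by move=> _ [W [W1 Wr] <-]; rewrite ler_pdivrMr// le.
Qed.

(** The domain of [t] is finite-dimensional, and the coordinates of [x] in an orthonormal basis are
    at most [|x|]. *)
Lemma implementing_map_bounded_finite :
  finite_rank (Pi p1) -> bounded_on range1 t.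
Proof.
move=> [n [v vE]]; have vr i : range1 (v i) by rewrite vE; exact: spanned_mem.
have [s [_ sr sE]] := orthonormal_basis_exists range1_subspace vr.
exists (\sum_(y <- s) nr y * nr (t y)) => x xr.
have E : x = \sum_(y <- s) inner x y *: y.
  by apply/eqP; rewrite -subr_eq0 -[_ - _]/(residual s x) sE// -vE.
rewrite {1}E (linear_on_sum range1_subspace t_linear)// mulr_suml.
elim: s {sr sE E} => [|y s IH]; first by rewrite !big_nil normr_re0.
rewrite !big_cons; apply: le_trans (ler_normr_reD _ _) _; rewrite lerD//.
by rewrite normr_reZ mulrAC ler_wpM2r ?normr_re_ge0// mulrC nr_inner_le.
Qed.

Lemma implementing_map_unbounded (M d : R) : ~ bounded_on range1 t -> 0 < d ->
  exists y, [/\ range1 y, nr y <= d & M < nr (t y)].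
Proof.
move=> tu d0; have [y yr ty] : exists2 y, range1 y & M / d * nr y < nr (t y).
  apply: contrapT => h; apply: tu; exists (M / d) => y yr.
  by rewrite leNgt; apply/negP => ty; apply: h; exists y.
have t0 := linear_on0 range1_subspace t_linear.
have y0 : 0 < nr y.
  rewrite nr_gt0; apply/eqP => y0; move: ty.
  by rewrite y0 t0 !normr_re0 mulr0 ltxx.
have dy0 : 0 < d / nr y by rewrite divr_gt0.
exists ((d / nr y)%:C *: y); split; first exact: subspaceZ.
  by rewrite nr_scale_real ?(ltW dy0)// divfK// gt_eqF.
rewrite (linear_onZ range1_subspace t_linear)// nr_scale_real ?(ltW dy0)//.
rewrite -ltr_pdivrMl// invf_div mulrC; apply: le_lt_trans ty.
by rewrite mulrA mulrAC.
Qed.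

Lemma orthonormal_extension s : ~ finite_rank (Pi p2) -> orthonormal s ->
  (forall y, y \in s -> range2 y) ->
  exists2 x, range2 x & orthonormal (x :: s).
Proof.
move=> infinite so sr; have r2 := rep_ext_range_subspace p2.
have [x xr x0] : exists2 x, range2 x & residual s x != 0.
  apply: contrapT => h; apply: infinite.
  exists (size s), (fun i => s`_i); apply/seteqP; split=> [x xr|].
    exists (fun i : 'I__ => inner x s`_i) => //.
    have : residual s x = 0.
      by have [//|x0] := eqVneq (residual s x) 0; case: h; exists x.
    by move=> /eqP; rewrite subr_eq0 (big_nth 0) big_mkord => /eqP.
  by apply: spanned_sub => // i; apply: sr; rewrite mem_nth.
exists ((nr (residual s x))^-1%:C *: residual s x).
  by apply: subspaceZ => //; exact: residual_sub.
exact: orthonormal_cons.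
Qed.

(* Gliding hump: each [F n] is small, vanishes under [pi] at the earlier
   orthonormal vectors, and makes the value of [t] at the current one large. *)
Lemma implementing_map_bounded_closed :
  closed X -> ~ finite_rank (Pi p2) -> bounded_on range1 t.
Proof.
move=> cX infinite; apply: contrapT => tu.
have /choice[next nextP] (s : seq H) : exists x : H,
    orthonormal s -> (forall y, y \in s -> range2 y) ->
    range2 x /\ orthonormal (x :: s).
  have [so|?] := pselect (orthonormal s); last by exists 0.
  have [sr|?] := pselect (forall y, y \in s -> range2 y); last by exists 0.
  by have [x xr xo] := orthonormal_extension infinite so sr; exists x.
pose L := fix L n : seq H := if n is n.+1 then next (L n) :: L n else [::].
have LP n : orthonormal (L n) /\ forall y, y \in L n -> range2 y.
  elim: n => [|n [so sr]]; first by split.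
  have [xr xo] := nextP _ so sr; split=> // y.
  by rewrite inE => /predU1P[->|/sr].
pose v n := next (L n).
have vr n : range2 (v n) by have [so sr] := LP n; have [] := nextP _ so sr.
have vo n : orthonormal (v n :: L n).
  by have [so sr] := LP n; have [] := nextP _ so sr.
have vL m n : (m < n)%N -> v m \in L n.
  elim: n => // n IH; rewrite ltnS leq_eqVlt => /predU1P[->|/IH mn] /=.
    by rewrite mem_head.
  by rewrite inE mn orbT.
have v1 n : nr (v n) = 1 by have [] := vo n.
have v_orth m n : (m < n)%N -> inner (v m) (v n) = 0.
  by move=> mn; have [_ h _] := vo n; apply: h; exact: vL.
have /choice[step stepP] (nG : nat * bidual A) : exists F, X nG.2 ->
    [/\ X F, nr F <= 2^-1 ^+ nG.1.+1,
      forall m, (m < nG.1)%N -> Pi F (v m) = 0 &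
      nG.1%:R < nr (t (Pi (nG.2 + F) (v nG.1)))].
  case: nG => n G /=; have [XG|] := pselect (X G); last by exists 0.
  pose e (i : 'I_n.+1) := v i; pose V := spanned e.
  have Vf : finite_dim V by exists n.+1, e.
  have Vr : V `<=` range2.
    by apply: spanned_sub => [|i]; [exact: rep_ext_range_subspace|exact: vr].
  have V0 : V <> [set 0].
    by apply: (@spanned_neq0 _ _ ord_max); rewrite -nr_gt0 v1.
  have k0 := constant_gt0 Vf Vr V0.
  (* The constant of [V] may grow with [n]; this size of [y] cancels it and leaves a summable bound
     on [F]. *)
  pose d := 2^-1 ^+ n.+1 / k pi V.
  have d0 : 0 < d by rewrite divr_gt0// exprn_gt0// invr_gt0.
  (* The threshold includes the contribution of the earlier humps at [v n], so that adding the new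
     one still leaves more than [n]. *)
  have [y [yr yd ty]] :=
    implementing_map_unbounded (n%:R + nr (t (Pi G (v n)))) tu d0.
  (* With [v n] as functional, orthogonality makes the hump vanish at all earlier vectors. *)
  have [F [XF Fk FV]] := interpolation (v n) Vf Vr V0 yr.
  have Fv m (mn : (m < n.+1)%N) : Pi F (v m) = inner (v m) (v n) *: y.
    by apply: FV; exact: (spanned_mem e (Ordinal mn)).
  exists F; split=> // [|m mn|].
  - by apply: le_trans Fk _; rewrite v1 mul1r mulrC -ler_pdivlMr.
  - by rewrite Fv ?v_orth ?scale0r// ltnW.
  rewrite rep_extD Fv// inner_xx v1 expr1n scale1r.
  rewrite (linear_onD t_linear)//; last first.
    by exists (Pi G (v n)) => //; have [] := corner_rep_ext (v n) XG.
  have := nr_le_dist (t y) (- t (Pi G (v n))); rewrite opprK nrN.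
  by rewrite [t y + _]addrC; lra.
pose G := fix G n : bidual A := if n is n.+1 then G n + step (n, G n) else 0.
have XG n : X (G n).
  elim: n => [|n IH]; first exact: hX.1.
  by apply: subspaceD => //; have [] := stepP (n, G n) IH.
have [Goo GP] : exists l, nr_cvg G l.
  apply: blin_nr_complete; first exact: complex_nr_complete.
  apply: (@nr_cauchy_majorant _ _ _ (fun n => 1 - 2^-1 ^+ n) 1) => n; last first.
    by rewrite gerBl exprn_ge0// invr_ge0.
  have -> : 1 - 2^-1 ^+ n.+1 - (1 - 2^-1 ^+ n) = 2^-1 ^+ n.+1 :> R.
    by rewrite exprS; move: (2^-1 ^+ n) => p; field.
  by rewrite /= addrC addKr; have [] := stepP (n, G n) (XG n).
have XGoo : X Goo := closed_nr_cvg cX XG GP.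
(* Later humps vanish at [v n], so the value there is final from stage [n.+1] on. *)
have Gv n m : (n < m)%N -> Pi (G m) (v n) = Pi (G n.+1) (v n).
  elim: m => // m IH; rewrite ltnS leq_eqVlt => /predU1P[->//|nm].
  rewrite -IH// -[G m.+1]/(G m + step (m, G m)) rep_extD.
  by have [_ _ h _] := stepP (m, G m) (XG m); rewrite h// addr0.
have Goov n : Pi Goo (v n) = Pi (G n.+1) (v n).
  apply: (@nr_cvg_unique _ _ (fun m => Pi (G m) (v n))).
    apply: (nr_cvg_lip (f := fun F => Pi F (v n)) (C := 1) _ GP) => F F'.
    by rewrite -rep_extB mul1r -[leRHS]mulr1 -(v1 n) rep_ext_le.
  move=> e e0; exists n.+1 => m nm.
  by rewrite Gv// subrr normr_re0.
(* [n] exceeds [|T Goo|], whereas [Pi (T Goo)] has norm above [n] at the unit vector [v n]. *)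
pose n := (Num.truncn (nr (T Goo))).+1.
have [_ _ _] := stepP (n, G n) (XG n).
rewrite -[_ + _]/(G n.+1) -Goov -ht.2// => /lt_le_trans/(_ (rep_ext_le _ _ _)).
by rewrite v1 mulr1 ltNge (ltW (truncnS_gt _)).
Qed.

End implementing_map.
End nonzero.
End implementation.

(** * The closed graph theorem and automatic boundedness *)

Section closed_graph.
Context {R : realType} {V W : normedModType R[i]}.
Hypotheses (cV : nr_complete V) (cW : nr_complete W).
Variables (X : set V) (T : V -> W).
Hypotheses (hX : linear_subspace X) (cX : closed X) (hT : linear_on X T).

(** Baire's argument for the sets [|T y| <= n] in [X]. If none were dense in a ball, one could nest
    balls, each avoiding the next of these sets, and their common point would have no value under
    [T]. *)
Lemma baire_ball : exists (n : nat) (c : V) (d : R), [/\ X c, 0 < d &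
  forall x, X x -> nr (x - c) < d -> forall e : R, 0 < e ->
    exists y, [/\ X y, nr (T y) <= n%:R & nr (y - x) < e]].
Proof.
apply: contrapT => nobaire.
have /choice[step stepP] (p : nat * (V * R)) : exists q : V * R,
    X p.2.1 -> 0 < p.2.2 -> [/\ X q.1, 0 < q.2, nr (q.1 - p.2.1) + q.2 <= p.2.2 &
      forall y, X y -> nr (T y) <= p.1%:R -> q.2 < nr (y - q.1)].
  case: p => n [c d] /=.
  have [Xc|] := pselect (X c); last by exists (0, 0).
  have [d0|] := pselect (0 < d); last by exists (0, 0).
  apply: contrapT => h; apply: nobaire; exists n, c, d; split=> // x Xx xc e e0.
  apply: contrapT => noy; apply: h.
  pose r := Num.min e (d - nr (x - c)) / 2.
  have m0 : 0 < Num.min e (d - nr (x - c)) by rewrite lt_min e0 subr_gt0.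
  have re : r < e.
    apply: (@lt_le_trans _ _ (Num.min e (d - nr (x - c)))); first by rewrite /r; lra.
    by rewrite ge_min lexx.
  have rd : r < d - nr (x - c).
    apply: (@lt_le_trans _ _ (Num.min e (d - nr (x - c)))); first by rewrite /r; lra.
    by rewrite ge_min lexx orbT.
  exists (x, r) => _ _; split=> //=; first by rewrite divr_gt0.
    by rewrite addrC -lerBrDr ltW.
  move=> y Xy Ty; apply: lt_le_trans re _; rewrite leNgt; apply/negP => ye.
  by apply: noy; exists y.
pose s := fix s n : V * R := if n is n.+1 then step (n, s n) else (0, 1).
have sP n : X (s n).1 /\ 0 < (s n).2.
  elim: n => [|n [Xs s0]]; first by split; [exact: hX.1|exact: ltr01].
  by have [] := stepP (n, s n) Xs s0.
have sS n : nr ((s n.+1).1 - (s n).1) <= - (s n.+1).2 - - (s n).2.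
  have [Xs s0] := sP n; have [_ _ h _] := stepP (n, s n) Xs s0.
  by move: h; rewrite -/(s n.+1) /=; lra.
have [l sl] : exists l, nr_cvg (fun n => (s n).1) l.
  apply: cV; apply: (@nr_cauchy_majorant _ _ _ (fun n => - (s n).2) 0) => // n.
  by rewrite oppr_le0 ltW//; have [] := sP n.
have Xl : X l by apply: (closed_nr_cvg cX _ sl) => n; have [] := sP n.
have ls n : nr (l - (s n).1) <= (s n).2.
  apply: (nr_cvg_dist_le (N := n) sl) => m nm.
  apply: le_trans (nr_telescope_le (b := fun n => - (s n).2) sS nm) _.
  by have [_] := sP m; rewrite opprK addrC gerDl oppr_le0 => /ltW.
(* The ball numbered [n.+1] avoids the set of index [n], which contains [l]; yet [l] lies in every
   ball. *)
pose n := (Num.truncn (nr (T l))).+1.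
have [Xs s0] := sP n; have [_ _ _ /(_ l Xl)] := stepP (n, s n) Xs s0.
have -> : nr (T l) <= n%:R by rewrite ltW// truncnS_gt.
by move=> /(_ isT); rewrite ltNge (ls n.+1).
Qed.

(** The ball is moved to the origin by subtracting an approximation of its centre, which doubles the
    bound [n]; homogeneity then extends it to all of [X]. The factor [2 / d] comes from rescaling to
    norm [d / 2], strictly inside the ball. *)
Lemma approximate_preimage_bound : exists2 M : R, 0 <= M &
  forall x, X x -> forall e : R, 0 < e ->
    exists y, [/\ X y, nr (T y) <= M * nr x & nr (y - x) < e].
Proof.
have [n [c [d [Xc d0 ball]]]] := baire_ball.
have origin x : X x -> nr x < d -> forall e : R, 0 < e ->
    exists y, [/\ X y, nr (T y) <= n%:R + n%:R & nr (y - x) < e].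
  move=> Xx xd e e0; have e2 : 0 < e / 2 by rewrite divr_gt0.
  have [||y [Xy Ty yx]] := ball (x + c) _ _ _ e2; rewrite ?addrK//.
    exact: subspaceD.
  have [|z [Xz Tz zc]] := ball c Xc _ _ e2; first by rewrite subrr normr_re0.
  exists (y - z); split; first exact: subspaceB.
    by rewrite (linear_onB hT)// (le_trans (ler_normr_reD _ _))// nrN lerD.
  have -> : y - z - x = (y - (x + c)) - (z - c).
    by rewrite !opprD opprK addrA [RHS]addrAC [in RHS]addrA subrK addrAC.
  by apply: le_lt_trans (ler_normr_reD _ _) _; rewrite nrN; lra.
exists ((n%:R + n%:R) * (2 / d)) => [|x Xx e e0].
  by rewrite mulr_ge0 ?addr_ge0// divr_ge0// ltW.
have [->|x0] := eqVneq x 0.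
  exists 0; split; [exact: hX.1| |by rewrite subrr normr_re0].
  by rewrite (linear_on0 hX hT) !normr_re0 mulr0.
have nx : 0 < nr x by rewrite nr_gt0.
pose a := d / 2 / nr x; have a0 : 0 < a by rewrite !divr_gt0.
have [|||y [Xy Ty yx]] := origin (a%:C *: x) _ _ (a * e).
- exact: subspaceZ.
- by rewrite nr_scale_real ?(ltW a0)// /a divfK ?gt_eqF//; lra.
- by rewrite mulr_gt0.
exists (a^-1%:C *: y); split; first exact: subspaceZ.
  rewrite (linear_onZ hX hT)// nr_scale_real ?invr_ge0 ?(ltW a0)//.
  rewrite [leLHS]mulrC -mulrA ler_pM ?invr_ge0 ?(ltW a0) ?normr_re_ge0//.
  by rewrite /a invf_div [leLHS]mulrC invf_div.
have aa : a^-1 * a = 1 by rewrite mulVf// gt_eqF.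
have {1}-> : x = a^-1%:C *: (a%:C *: x).
  by rewrite scalerA -rmorphM /= aa scale1r.
rewrite -scalerBr nr_scale_real ?invr_ge0 ?(ltW a0)//.
by rewrite mulrC ltr_pdivrMr// mulrC.
Qed.

(** Successive approximation: each remainder is at most half the previous bound, so [x] is a series
    whose images under [T] are dominated by a geometric series of sum [2 M |x|]. The closed graph
    identifies the limit of the images as [T x]. *)
Lemma closed_graph_bounded :
  (forall u l m, (forall n, X (u n)) -> nr_cvg u l -> nr_cvg (T \o u) m ->
    T l = m) -> bounded_on X T.
Proof.
move=> graph; have [M M0 approx] := approximate_preimage_bound.
exists (2 * M) => x Xx; have T0 := linear_on0 hX hT.
have [->|x0] := eqVneq x 0; first by rewrite T0 !normr_re0 mulr0.
have nx : 0 < nr x by rewrite nr_gt0.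
have pow0 n : 0 < 2^-1 ^+ n :> R by rewrite exprn_gt0// invr_gt0.
have /choice[step stepP] (p : nat * V) : exists y, X p.2 ->
    [/\ X y, nr (T y) <= M * nr p.2 & nr (y - p.2) < nr x * 2^-1 ^+ p.1.+1].
  have [Xp|] := pselect (X p.2); last by exists 0.
  have [|y yP] := approx _ Xp (nr x * 2^-1 ^+ p.1.+1); last by exists y.
  by rewrite mulr_gt0.
pose r := fix r n : V := if n is n.+1 then r n - step (n, r n) else x.
have Xr n : X (r n).
  elim: n => // n Xr; have [Xs _ _] := stepP (n, r n) Xr.
  exact: subspaceB.
have r_le n : nr (r n) <= nr x * 2^-1 ^+ n.
  case: n => [|n]; first by rewrite expr0 mulr1.
  by rewrite /= nrBC ltW//; have [] := stepP (n, r n) (Xr n).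
pose S n := x - r n.
have XS n : X (S n) by apply: subspaceB.
have TS n : nr (T (S n.+1) - T (S n)) <=
    2 * M * nr x * (1 - 2^-1 ^+ n.+1) - 2 * M * nr x * (1 - 2^-1 ^+ n).
  have [Xs Ts _] := stepP (n, r n) (Xr n).
  have -> : T (S n.+1) - T (S n) = T (step (n, r n)).
    rewrite -(linear_onB hT)//; congr T.
    by rewrite /S /= (opprB (r n)) addrCA addrK.
  apply: le_trans Ts _; have := ler_wpM2l M0 (r_le n).
  by rewrite exprS /=; move: (2^-1 ^+ n) => p; lra.
have bound_le n : 2 * M * nr x * (1 - 2^-1 ^+ n) <= 2 * M * nr x.
  rewrite ler_piMr ?mulr_ge0 ?normr_re_ge0//.
  by rewrite gerBl ltW.
have [m Tm] : exists m, nr_cvg (T \o S) m.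
  apply: cW; apply: (nr_cauchy_majorant (b := fun n => 2 * M * nr x * (1 - 2^-1 ^+ n))) => //.
have Sx : nr_cvg S x.
  move=> e e0; have [N] : exists N, forall n, (N <= n)%N -> nr x * 2^-1 ^+ n < e.
    exists (Num.truncn (nr x / e)).+1 => n Nn.
    rewrite exprVn ltr_pdivrMr ?exprn_gt0// mulrC -ltr_pdivrMr//.
    apply: lt_le_trans (truncnS_gt _) _; rewrite -natrX ler_nat.
    by rewrite (leq_trans Nn)// ltnW// ltn_expl.
  move=> rN; exists N => n /rN; apply: le_lt_trans.
  by rewrite /S addrAC subrr add0r nrN.
rewrite (graph S x m)//; apply: nr_cvg_le Tm _ => n /=.
have := nr_telescope_le TS (leq0n n); rewrite /S /= subrr T0 subr0.
by rewrite expr0 subrr mulr0 subr0 => /le_trans; apply.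
Qed.

End closed_graph.

(** * From irreducible representations to the atomic one *)

Section direct_sum.
Context {R : realType} {A : cstarAlgType R}.

Lemma direct_sum_rep_ext_eq0 (I : Type) (H : I -> hilbertType R)
    (pi : forall i, representation A (H i)) (K : hilbertType R)
    (rho : representation A K) (F : bidual A) :
  is_direct_sum pi rho -> (forall i, rep_ext (pi i) F = 0) -> rep_ext rho F = 0.
Proof.
move=> [U [Ul _ Udense Upi]] F0.
have FU i x : rep_ext rho F (U i x) = 0.
  apply: inner_ext => w; rewrite inner0l rep_ext_coef.
  (* [w'] is the adjoint of [U i] applied to [w]; it turns a coefficient of [rho] into one of
     [pi i]. *)
  have [||||w' w'E _] := @riesz _ (H i) _ idfun (fun y => inner (U i y) w) (nr w) => //.
  - by move=> c a b; rewrite (Ul i).1 inner_linearl.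
  - exact: normr_re_ge0.
  - move=> b; apply: le_trans (nr_inner_le _ _) _; rewrite mulrC /=.
    have -> // : nr (U i b) = nr b.
    by apply/eqP; rewrite -(@eqrXn2 _ 2)// ?normr_re_ge0// -!Re_inner_xx (Ul i).2.
  have -> : coef rho (U i x) w = coef (pi i) x w'.
    by apply/blinP => a /=; rewrite -Upi w'E.
  by rewrite -rep_ext_coef F0 blin0E inner0l.
apply/blinP => z; rewrite blin0E.
suff : [set z | rep_ext rho F z = 0] = [set: K].
  by move=> E; have : [set: K] z by []; rewrite -E.
apply: Udense => //.
- split=> [|c x y /= x0 y0]; first exact: blin_app0.
  by rewrite blin_appD blin_appZ x0 y0 scaler0 addr0.
- apply: (closed_ker (C := nr (rep_ext rho F))) => x y.
  by rewrite -blin_appB blin_le.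
Qed.

End direct_sum.

(** * Closedness of the graph of [T] *)

Section automatic_continuity.
Context {R : realType} {A : cstarAlgType R}.
Variables (p1 p2 : bidual A) (X : set (bidual A)) (k : constants A)
  (T : bidual A -> bidual A).
Hypotheses (hp1 : projection p1) (hp2 : projection p2) (hX : linear_subspace X)
  (hXp : X `<=` corner p1 p2) (hK : condition_K p1 p2 X k)
  (hT : linear_on X T) (hTpd : purely_decomposable X T).

Lemma rep_ext_T_closed_graph (H : hilbertType R) (pi : representation A H)
    (u : nat -> bidual A) F G : irreducible pi -> closed X ->
  [\/ rep_ext pi p2 = 0, ~ finite_rank (rep_ext pi p2) |
      finite_rank (rep_ext pi p1)] ->
  (forall n, X (u n)) -> nr_cvg u F -> nr_cvg (T \o u) G ->
  rep_ext pi (G - T F) = 0.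
Proof.
move=> irr cX cond Xu uF TuG; have XF := closed_nr_cvg cX Xu uF.
have ev (x : H) (v : nat -> bidual A) (E : bidual A) : nr_cvg v E ->
    nr_cvg (fun n => rep_ext pi (v n) x) (rep_ext pi E x).
  apply: (nr_cvg_lip (f := fun E => rep_ext pi E x) (C := nr x)) => E' E''.
  by rewrite -rep_extB mulrC rep_ext_le.
apply/blinP => x; rewrite rep_extB blin0E; apply/eqP; rewrite subr_eq0; apply/eqP.
apply: (nr_cvg_unique (ev x _ _ TuG)).
have zero : rep_ext pi p1 = 0 \/ rep_ext pi p2 = 0 ->
    nr_cvg (fun n => rep_ext pi ((T \o u) n) x) (rep_ext pi (T F) x).
  move=> /(rep_ext_T_eq0 hp1 hp2 hXp hTpd irr) T0.
  rewrite T0//; rewrite (_ : (fun n => _) = fun=> (0 : 'B(H, H)) x).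
    exact: nr_cvg_cst.
  by apply/funext => n; rewrite /= T0.
have [p1_eq0|p1_neq0] := eqVneq (rep_ext pi p1) 0; first by apply: zero; left.
have [p2_eq0|p2_neq0] := eqVneq (rep_ext pi p2) 0; first by apply: zero; right.
have [t ht] := implementing_map_exists hp1 hp2 hX hXp hK hT hTpd irr p1_neq0 p2_neq0.
have [M tM] : bounded_on (range (rep_ext pi p1)) t.
  case: cond => [p2_eq0|infinite|finite].
  - by rewrite p2_eq0 eqxx in p2_neq0.
  - exact: (implementing_map_bounded_closed hp1 hp2 hX hXp hK irr p1_neq0 p2_neq0 ht).
  - exact: (implementing_map_bounded_finite ht).
have r1 E : X E -> range (rep_ext pi p1) (rep_ext pi E x).
  by move=> XE; exists (rep_ext pi E x) => //; have [] := corner_rep_ext hp1 hp2 hXp pi x XE.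
move=> e e0; have C0 : 0 < `|M| + 1 by rewrite ltr_wpDl.
have [N uN] := ev x _ _ uF (e / (`|M| + 1)) (divr_gt0 e0 C0).
exists N => n /uN; rewrite /= ltr_pdivlMr// => un.
rewrite (ht.2 _ (Xu n)) (ht.2 _ XF) -(linear_onB ht.1 (r1 _ (Xu n)) (r1 _ XF)).
apply: le_lt_trans un.
apply: le_trans (tM _ _) _.
  by apply: subspaceB; [exact: rep_ext_range_subspace|exact: r1|exact: r1].
rewrite [leRHS]mulrC ler_wpM2r ?normr_re_ge0// (le_trans (ler_norm _))//.
by rewrite lerDl.
Qed.

Lemma purely_decomposable_bounded : closed X -> type_U (T @` X) ->
  (forall (H : hilbertType R) (pi : representation A H), irreducible pi ->
    [\/ rep_ext pi p2 = 0, ~ finite_rank (rep_ext pi p2) |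
        finite_rank (rep_ext pi p1)]) ->
  bounded_on X T.
Proof.
move=> cX [K [pi_a [[I [H [pi [irr _ _ sum]]]] typeU]]] cond.
have cC := @complex_nr_complete R.
apply: closed_graph_bounded => //; try exact: blin_nr_complete.
move=> u F G Xu uF TuG; have XF := closed_nr_cvg cX Xu uF.
apply/esym/eqP; rewrite -subr_eq0; apply/eqP; apply: typeU; last first.
  apply: direct_sum_rep_ext_eq0 sum _ => i.
  by apply: rep_ext_T_closed_graph Xu uF TuG => //; exact: cond.
(* [G - T F] is the limit of [T (u n - F)], so it lies in the closure of the image, where type U
   applies. *)
apply/closure_nrP => e /TuG[N uN]; exists (T (u N - F)).
  by exists (u N - F) => //; exact: subspaceB.
rewrite (linear_onB hT)//.
have -> : T (u N) - T F - (G - T F) = (T \o u) N - G by rewrite opprB addrA subrK.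
exact: uN.
Qed.

End automatic_continuity.

Theorem theorem3p6 (R : realType) (A : cstarAlgType R) (p1 p2 : bidual A)
    (X : set (bidual A)) (k : constants A) (T : bidual A -> bidual A)
    (hp1 : projection p1) (hp2 : projection p2)
    (hX : linear_subspace X) (hXp : X `<=` corner p1 p2)
    (hK : condition_K p1 p2 X k)
    (hT : linear_on X T) (hTpd : purely_decomposable X T) :
  [/\ (* (a) *)
      forall (H : hilbertType R) (pi : representation A H), irreducible pi ->
        (rep_ext pi p1 != 0 -> rep_ext pi p2 != 0 ->
          exists t : H -> H, implements p1 X T pi t) /\
        (rep_ext pi p1 = 0 \/ rep_ext pi p2 = 0 ->
          forall F, X F -> rep_ext pi (T F) = 0),
      (* (b) *)
      forall (H : hilbertType R) (pi : representation A H) (t : H -> H),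
        irreducible pi -> rep_ext pi p1 != 0 -> rep_ext pi p2 != 0 ->
        implements p1 X T pi t -> bounded_on X T ->
        bounded_on (range (rep_ext pi p1)) t /\
        opnorm_on (range (rep_ext pi p1)) t <=
          constant_inf p2 k pi * opnorm_on X T,
      (* (c) *)
      forall (H : hilbertType R) (pi : representation A H) (t : H -> H),
        irreducible pi -> rep_ext pi p1 != 0 -> rep_ext pi p2 != 0 ->
        implements p1 X T pi t -> closed X ->
        ~ finite_rank (rep_ext pi p2) \/ finite_rank (rep_ext pi p1) ->
        bounded_on (range (rep_ext pi p1)) t &
      (* (d) *)
      closed X -> type_U (T @` X) ->
      (forall (H : hilbertType R) (pi : representation A H), irreducible pi ->
        [\/ rep_ext pi p2 = 0, ~ finite_rank (rep_ext pi p2) |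
            finite_rank (rep_ext pi p1)]) ->
      bounded_on X T].
Proof.
split=> [H pi irr|H pi t irr p1_neq0 p2_neq0 ht Tb|H pi t irr p1_neq0 p2_neq0 ht cX|].
- split=> [p1_neq0 p2_neq0|].
    exact: (implementing_map_exists hp1 hp2 hX hXp hK hT hTpd irr).
  exact: (rep_ext_T_eq0 hp1 hp2 hXp hTpd irr).
- exact: (implementing_map_bounded hp1 hX hK hT irr).
- move=> [infinite|finite].
    exact: (implementing_map_bounded_closed hp1 hp2 hX hXp hK irr p1_neq0 p2_neq0 ht).
  exact: (implementing_map_bounded_finite ht).
- exact: (purely_decomposable_bounded hp1 hp2 hX hXp hK hT hTpd).
Qed.
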